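(* Let $\{S_k\}_{k\ge 0}$ be a simple random walk on $\mathbb{Z}^2$ started at $S_0=0$. For $0<\alpha<1$ and $n\in\mathbb{N}$ let $$\Psi_n(\alpha):=\Big\{x\in D(0,n): K(\tau_n,x)\ge \Big\lceil \tfrac{4\alpha}{\pi}(\log n)^2\Big\rceil\Big\}.$$ Then for any $0<\alpha,\beta<1$, $$\lim_{n\to\infty}\frac{\log E\big[\big|\{(x,x')\in\Psi_n(\alpha)^2: d(x,x')\le n^{\beta}\}\big|\big]}{\log n}=\hat\rho_2(\alpha,\beta),$$ where $$\hat\rho_2(\alpha,\beta):=\begin{cases}2+2\beta-\frac{4\alpha}{2-\beta}, & \beta\le 2-\sqrt{2\alpha},\\ 6-4\sqrt{2\alpha}, & \beta\ge 2-\sqrt{2\alpha}.\end{cases}$$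
   Context: $d$ is the Euclidean distance on $\mathbb{Z}^2$; $D(x,r):=\{y\in\mathbb{Z}^2: d(x,y)\le r\}$. For $G\subset\mathbb{Z}^2$, $\partial G:=\{y\in G^c: d(x,y)=1\text{ for some }x\in G\}$. $K(m,x):=\sum_{i=0}^m 1_{\{S_i=x\}}$ is the number of visits to $x$ up to time $m$, and $\tau_n:=\inf\{m\ge 0: S_m\in\partial D(0,n)\}$. $\lceil a\rceil$ is the smallest integer $\ge a$. $E$ denotes expectation for the walk started at $0$. *)

(* Defs.v *)
From HB Require Import structures.
From mathcomp Require Import all_boot all_order all_algebra.
From mathcomp Require Import all_classical all_reals all_analysis.
Set Implicit Arguments. Unset Strict Implicit. Unset Printing Implicit Defensive.
Import Order.TTheory GRing.Theory Num.Theory.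
Local Open Scope ring_scope.

Definition Z2 := (int * int)%type.

Definition addp (a b : Z2) : Z2 := (a.1 + b.1, a.2 + b.2).

Definition step (k : 'I_4) : Z2 :=
  match val k with
  | 0%N => (1, 0) | 1%N => (-1, 0) | 2%N => (0, 1) | _ => (0, -1) end.

Definition pos (s : seq 'I_4) (i : nat) : Z2 :=
  foldl (fun p k => addp p (step k)) (0, 0) (take i s).

Definition dist2 (x y : Z2) : int := (x.1 - y.1) ^+ 2 + (x.2 - y.2) ^+ 2.
Definition d {R : realType} (x y : Z2) : R := Num.sqrt ((dist2 x y)%:~R).

Definition inD {R : realType} (c : Z2) (r : R) (x : Z2) : bool := d c x <= r.

Definition inBd {R : realType} (n : nat) (y : Z2) : Prop :=
  ~~ inD (0, 0) (n%:R : R) y /\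
  exists x : Z2, inD (0, 0) (n%:R : R) x /\ d x y = (1 : R).

Definition firstHit (R : realType) (n : nat) (s : seq 'I_4) : Prop :=
  inBd (R := R) n (pos s (size s)) /\
  forall i, (i < size s)%N -> ~ inBd (R := R) n (pos s i).

Definition K (s : seq 'I_4) (m : nat) (x : Z2) : nat :=
  count (fun i => pos s i == x) (iota 0 m.+1).

(* x \in Psi_n(alpha), for a path s stopped at tau_n = size s *)
Definition inPsi {R : realType} (alpha : R) (n : nat) (s : seq 'I_4) (x : Z2)
  : bool :=
  inD (0, 0) (n%:R : R) x &&
  (Num.ceil (4 * alpha / pi * (ln (n%:R : R)) ^+ 2) <= (K s (size s) x)%:Z).

(* a finite box containing D(0,n) *)
Definition box (n : nat) : seq Z2 :=
  [seq (i%:Z - n%:Z, j%:Z - n%:Z) | i <- iota 0 (2 * n).+1, j <- iota 0 (2 * n).+1].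

Definition pairCount {R : realType} (alpha beta : R) (n : nat) (s : seq 'I_4)
  : nat :=
  (\sum_(x <- box n) \sum_(y <- box n)
     nat_of_bool [&& inPsi alpha n s x, inPsi alpha n s y &
                    (d x y <= (n%:R : R) `^ beta)%R])%N.

(* E[|...|]: the count depends only on (S_0,...,S_{tau_n}); tau_n is the
   first time m such that the length-m step sequence satisfies firstHit,
   and each length-m step sequence has probability 4^-m. *)
Definition Epairs {R : realType} (alpha beta : R) (n : nat) : R :=
  limn (fun N : nat => \sum_(0 <= m < N)
    ((4 : R)^-1 ^+ m *
     \sum_(t : m.-tuple 'I_4 | `[< firstHit R n (tval t) >])
        (pairCount alpha beta n (tval t))%:R)).

Definition rho2 {R : realType} (alpha beta : R) : R :=
  if beta <= 2 - Num.sqrt (2 * alpha)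
  then 2 + 2 * beta - 4 * alpha / (2 - beta)
  else 6 - 4 * Num.sqrt (2 * alpha).

(* Main.v *)
(* The expectation is a sum over pairs (x, y) of P(K_x >= T, K_y >= T), which is
   computed with discrete harmonic functions only.  Let a be the potential kernel:
   a(0) = 0, the four-point average of a is a + 1_0, and a(z) = (2/pi) log|z| + O(1).
   At the even site (i + j, i - j) it is the sum over k of b_k(0)^2 - b_k(i) b_k(j), where
   b_k is the law of the lazy one-dimensional walk; pi enters through Wallis' bounds on b_k(0).
   Write L = log n and |x - y| = n^g.
   The function 1 - (a(.-x) + a(.-y) - a(x-y)) / (2M - a(x-y)), with M the maximum of a on
   the relevant disc, is harmonic off {x, y} and equal to 1 at x and y; it shows that each
   visit to {x, y} is followed by another one before exit with probability at most
   1 - 1/(2M - a(x-y)), where 2M - a(x-y) = (2/pi)(2-g)L + O(1).  Since T = (4 alpha/pi) L^2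
   this gives P <= C n^(-4 alpha/(2-g)).
   Conversely similar combinations of a bound below the probabilities p and q that a visit
   to x is followed by a visit to x, resp. to y, with p + q = 1 - 1/m and m = (2/pi)(2-g)L - O(1).
   The words with T letters x and T letters y carry the weight
   q sum_k (binom(T-1,k) p^(T-1-k) q^k)^2, which by Cauchy-Schwarz is at least
   (q/T) (p+q)^(2T-2).
   Finally 2 + 2g - 4 alpha/(2-g) is maximised over g <= beta. *)
Require Import Defs.
From HB Require Import structures.
From mathcomp Require Import all_boot all_order all_algebra.
From mathcomp Require Import all_classical all_reals all_analysis.
From mathcomp Require Import ring lra zify.
Import Order.TTheory GRing.Theory Num.Theory numFieldNormedType.Exports.
Local Open Scope classical_set_scope.
Local Open Scope ring_scope.
Set Implicit Arguments.
Unset Strict Implicit.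
Unset Printing Implicit Defensive.

(** * The potential kernel *)

Section LazyWalk.
Context {R : realType}.

(** The scales decide which precision matters. T is of order L^2 and the inverse escape rate m of
    order L, so an error O(1) in m changes T/m by O(1) and the probability by a bounded factor.
    Hence the kernel is needed up to O(1) only, with crude constants, and any loss of a power of L
    disappears after division by L. The factor 2/pi of the logarithm must be exact, since it fixes
    the exponent. For the lower bound the stand-ins for hitting probabilities must be at most 0
    outside the disc, yet positive at the origin. Two margins achieve this: m is lowered by a
    constant [c0], and x, y are taken at distance of order n/K from the origin, K a large constant,
    which makes their kernel values there smaller than at the boundary by about (2/pi) ln K. The
    start then costs a factor 1/m. The two stand-ins mirror each other, so that p and q serve both
    sites. Probabilities are limits of quantities with at most N steps. Upper bounds pass to the
    limit at once; in lower bounds the paths still inside the disc are controlled by a function of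
    the type n^2 - |z|^2, which loses 1 per step on average. *)

Fixpoint lazyp (k : nat) (i : int) : R :=
  if k is k'.+1 then
    (lazyp k' (i - 1) + 2 * lazyp k' i + lazyp k' (i + 1)) / 4
  else (i == 0)%:R.

Lemma lazyp_ge0 k i : 0 <= lazyp k i.
Proof.
elim: k i => [|k IH] i /=; first by rewrite ler0n.
have := IH (i - 1); have := IH i; have := IH (i + 1); lra.
Qed.

Lemma lazypN k i : lazyp k (- i) = lazyp k i.
Proof.
elim: k i => [|k IH] i /=; first by rewrite oppr_eq0.
rewrite IH -(IH (i - 1)) -(IH (i + 1)) opprB opprD [1 - i]addrC; lra.
Qed.

(** [lazyp k i] is binom(2k, k + i) / 4^k, and this is the ratio of two neighbouring binomials,
    cross-multiplied so that vanishing factors do no harm. The estimates of the lazy walk below are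
    drawn from it. *)
Lemma lazyp_ratio k (i : int) :
  (k%:R + i%:~R) * lazyp k i = (k%:R - i%:~R + 1) * lazyp k (i - 1).
Proof.
elim: k i => [|k IH] i /=.
  rewrite subr_eq0; have [->|i0] := eqVneq i 0; first by rewrite /= addr0 mul0r mulr0.
  rewrite mulr0; have [->|i1] := eqVneq i 1; last by rewrite mulr0.
  by rewrite add0r addNr mul0r.
have := IH i; have := IH (i - 1); have := IH (i + 1).
rewrite addrK subrK !intrD !rmorphN /= -[k.+1%:R]natr1.
set b0 := lazyp k i; set b1 := lazyp k (i + 1); set b2 := lazyp k (i - 1).
set b3 := lazyp k _.
move=> h1 h2 h3.
lra.
Qed.

Lemma lazyp_nat_ratio k (l : nat) :
  (k%:R + l%:R + 1) * lazyp k l.+1%:Z = (k%:R - l%:R) * lazyp k l%:Z.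
Proof.
have := lazyp_ratio k l.+1%:Z.
have -> : l.+1%:Z - 1 = l%:Z by lia.
by rewrite -pmulrn -natr1 => h; lra.
Qed.

Lemma lazyp_abs k (i : int) : lazyp k i = lazyp k `|i|%N%:Z.
Proof. by case: (intP i) => // n; rewrite lazypN. Qed.

Lemma lazyp_small k (l : nat) : (k < l)%N -> lazyp k l%:Z = 0.
Proof.
elim: l => // l IH; rewrite ltnS leq_eqVlt => /predU1P[->|/IH h].
- have := lazyp_nat_ratio l l; rewrite subrr mul0r => /eqP.
  rewrite mulf_eq0 => /orP[|/eqP//]; have : 0 <= l%:R :> R by [].
  by move=> h /eqP e; lra.
- have := lazyp_nat_ratio k l; rewrite h mulr0 => /eqP.
  rewrite mulf_eq0 => /orP[|/eqP//].
  have : 0 <= l%:R :> R by []. have : 0 <= k%:R :> R by [].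
  by move=> h1 h2 /eqP e; lra.
Qed.

Lemma lazyp_step_le k (l : nat) : lazyp k l.+1%:Z <= lazyp k l%:Z.
Proof.
have := lazyp_nat_ratio k l; have := lazyp_ge0 k l.+1; have := lazyp_ge0 k l.
have : 0 <= l%:R :> R by []. have : 0 <= k%:R :> R by [].
set a := lazyp _ _; set b := lazyp _ _ => h1 h2 h3 h4 h5.
have : 0 < k%:R + l%:R + 1 :> R by lra.
by move=> h; rewrite -(ler_pM2l h) h5; nra.
Qed.

Lemma lazyp_le0 k i : lazyp k i <= lazyp k 0.
Proof.
rewrite [lazyp k i]lazyp_abs; elim: `|i|%N => // l; exact: le_trans (lazyp_step_le k l).
Qed.

Lemma sqr_absz_intr (i : int) : (i%:~R : R) ^+ 2 = (`|i|%N%:R) ^+ 2.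
Proof.
rewrite natr_absz; have [i0|i0] := leP 0 i; first by rewrite ger0_norm.
by rewrite ltr0_norm // rmorphN /= sqrrN.
Qed.

(** Going from l to l + 1 loses at most b_k(0) (2l + 1)/k, and the odd numbers add up to i^2.
    Informative for k large against i^2. *)
Lemma lazyp_ge k (i : int) : (0 < k)%N ->
  lazyp k 0 * (1 - (i%:~R) ^+ 2 / k%:R) <= lazyp k i.
Proof.
move=> k0; rewrite [lazyp k i]lazyp_abs.
have -> : (i%:~R : R) ^+ 2 = (`|i|%N%:R) ^+ 2.
  exact: sqr_absz_intr.
have k0' : 0 < k%:R :> R by rewrite ltr0n.
elim: `|i|%N => [|l IH]; first by rewrite mulr0n expr0n /= mul0r subr0 mulr1.
apply: le_trans (_ : lazyp k l - lazyp k 0 * ((2 * l%:R + 1) / k%:R) <= _).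
  apply: le_trans (lerB IH (lexx _)).
  by rewrite -natr1 le_eqVlt; apply/orP; left; apply/eqP; field; lra.
rewrite lerBlDl -lerBlDr.
have h := lazyp_nat_ratio k l; have hl := lazyp_le0 k l%:Z.
have hl0 : 0 <= l%:R :> R by [].
have -> : lazyp k l.+1%:Z = (k%:R - l%:R) * lazyp k l%:Z / (k%:R + l%:R + 1).
  by rewrite -h; field; lra.
have -> : lazyp k l - (k%:R - l%:R) * lazyp k l / (k%:R + l%:R + 1) =
  lazyp k l * ((2 * l%:R + 1) / (k%:R + l%:R + 1)) by field; lra.
apply: ler_pM => //; first exact: lazyp_ge0.
rewrite ler_pM2l; last by lra.
by rewrite lef_pV2 ?posrE; lra.
Qed.

(** A pointwise bound of Chebyshev type, complementing [lazyp_ge] when k is small against i^2. *)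
Lemma lazyp_sqr_le k (i : int) :
  lazyp k i * (i%:~R) ^+ 2 <= 2 * k%:R * lazyp k 0.
Proof.
rewrite [lazyp k i]lazyp_abs.
have -> : (i%:~R : R) ^+ 2 = (`|i|%N%:R) ^+ 2.
  exact: sqr_absz_intr.
have k0 : 0 <= k%:R :> R by [].
move: `|i|%N => I.
have [kI|Ik] := ltnP k I.
  by rewrite lazyp_small // mul0r mulr_ge0 ?lazyp_ge0 // mulr_ge0.
have [I0|I0] := posnP I.
  by rewrite I0 mulr0n expr0n mulr0 mulr_ge0 ?lazyp_ge0 // mulr_ge0.
have I0' : 0 < I%:R :> R by rewrite ltr0n.
have IkR : I%:R <= k%:R :> R by rewrite ler_nat.
(* The induction rests on (1 - x)(1 + S + y) <= 1 + S for y <= x. Freezing the denominator at k + I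
   makes S grow by exactly y when l grows by 1. *)
have key (l : nat) : (l <= I)%N ->
    lazyp k l%:Z * (1 + l%:R ^+ 2 / (k%:R + I%:R)) <= lazyp k 0.
  elim: l => [|l IH] lI; first by rewrite mulr0n expr0n /= mul0r addr0 mulr1 lexx.
  apply: le_trans (IH (ltnW lI)).
  have h := lazyp_nat_ratio k l; have hl := lazyp_ge0 k l%:Z.
  have hl0 : 0 <= l%:R :> R by [].
  have lI' : l%:R + 1 <= I%:R :> R by rewrite natr1 ler_nat.
  have -> : lazyp k l.+1%:Z = lazyp k l%:Z *
      (1 - (2 * l%:R + 1) / (k%:R + l%:R + 1)).
    have -> : lazyp k l.+1%:Z = (k%:R - l%:R) * lazyp k l%:Z / (k%:R + l%:R + 1).
      by rewrite -h; field; lra.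
    by field; lra.
  rewrite -mulrA ler_wpM2l //.
  have -> : l.+1%:R ^+ 2 / (k%:R + I%:R) =
    l%:R ^+ 2 / (k%:R + I%:R) + (2 * l%:R + 1) / (k%:R + I%:R) :> R.
    by rewrite -natr1; field; lra.
  set S := l%:R ^+ 2 / _; set y := (2 * l%:R + 1) / (k%:R + I%:R).
  set x := (2 * l%:R + 1) / _.
  have S0 : 0 <= S by rewrite divr_ge0 ?sqr_ge0 //; lra.
  have y0 : 0 <= y by apply: divr_ge0; lra.
  have xy : y <= x.
    by apply: ler_wpM2l; rewrite ?lef_pV2 ?posrE; lra.
  nra.
have := key I (leqnn I).
have -> : 1 + I%:R ^+ 2 / (k%:R + I%:R) = (k%:R + I%:R + I%:R ^+ 2) / (k%:R + I%:R) :> R.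
  by field; lra.
rewrite mulrA ler_pdivrMr; last by lra.
have := lazyp_ge0 k I%:Z; have := lazyp_ge0 k 0; nra.
Qed.

Lemma lazyp0S k :
  lazyp k.+1 0 = lazyp k 0 * ((2 * k%:R + 1) / (2 * k%:R + 2)).
Proof.
have -> : lazyp k.+1 0 = (lazyp k 1 + 2 * lazyp k 0 + lazyp k 1) / 4.
  by rewrite -{1}(lazypN k 1).
have := lazyp_nat_ratio k 0; rewrite !addr0 subr0 => h.
have k0 : 0 <= k%:R :> R by [].
have -> : lazyp k 1 = k%:R * lazyp k 0 / (k%:R + 1).
  by rewrite -h; field; lra.
by field; lra.
Qed.

End LazyWalk.

(** * Wallis integrals *)

Section Wallis.
Context {R : realType}.

(** The reduction formula for the antiderivative of cos^n that vanishes at 0; its value at pi/2 is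
    the Wallis integral, obtained without integration theory. *)
Fixpoint cos_pow_prim (n : nat) (x : R) : R :=
  match n with
  | 0%N => x
  | 1%N => sin x
  | m.+2 => m.+2%:R^-1 * (cos x ^+ m.+1 * sin x + m.+1%:R * cos_pow_prim m x)
  end.

Lemma is_derive_cos_pow_prim n (x : R) :
  is_derive x 1 (cos_pow_prim n) (cos x ^+ n).
Proof.
have [m] := ubnP n; elim: m n => // m IH [|[|n]] nm.
- by rewrite expr0; exact: is_derive_id.
- by rewrite expr1; exact: is_derive_sin.
have -> : cos_pow_prim n.+2 = n.+2%:R^-1 \*:
   ((@cos R ^+ n.+1 * @sin R) + n.+1%:R \*: cos_pow_prim n).
  by apply/funext => y; rewrite [LHS]/= [RHS]/GRing.scale_fun /GRing.scale /= !fctE.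
have hn := IH n (ltnW nm).
have hc := is_deriveM (is_deriveX n.+1 (is_derive_cos x)) (is_derive_sin x).
have := is_deriveZ n.+2%:R^-1 (is_deriveD hc (is_deriveZ n.+1%:R hn)).
move=> h; apply: (is_derive_eq h).
rewrite !fctE /=.
rewrite /GRing.scale /= !exprS.
have n2 : n.+2%:R != 0 :> R by rewrite pnatr_eq0.
have e := sin2cos2 x; have n1 : n%:R + 1 = n.+1%:R :> R := natr1 n.
have n1' : n.+1%:R + 1 = n.+2%:R :> R := natr1 n.+1.
move: (cos x) (sin x) (cos x ^+ n) e => C S X e.
apply: (mulfI n2); rewrite mulVKf // -n1' -n1.
have : (n%:R + 1) * X * (S * S) = (n%:R + 1) * X * (1 - C ^+ 2).
  by rewrite -e -expr2.
lra.
Qed.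

Lemma cos_pow_prim0 n : cos_pow_prim n (0 : R) = 0.
Proof.
have [m] := ubnP n; elim: m n => // m IH [|[|n]] nm //=; first exact: sin0.
by rewrite sin0 (IH n (ltnW nm)) !mulr0 addr0 mulr0.
Qed.

Definition wallis n : R := cos_pow_prim n (pi / 2).

Lemma wallis_rec n : wallis n.+2 = n.+1%:R / n.+2%:R * wallis n.
Proof.
by rewrite /wallis /= cos_pihalf expr0n /= mul0r add0r mulrA [_^-1 * _]mulrC.
Qed.

(** Mean value theorem for the difference of the two antiderivatives, whose derivative cos^n (1 -
    cos) is nonnegative on [0, pi/2]. *)
Lemma wallis_decr n : wallis n.+1 <= wallis n.
Proof.
have pi0 : 0 <= pi / 2 :> R by rewrite divr_ge0 // pi_ge0.
pose f : R -> R := cos_pow_prim n - cos_pow_prim n.+1.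
have df (x : R) : is_derive x 1 f (cos x ^+ n - cos x ^+ n.+1).
  by apply: is_deriveB; exact: is_derive_cos_pow_prim.
have [|c cin] := @MVT_segment R f (fun x => cos x ^+ n - cos x ^+ n.+1) 0 (pi / 2) pi0
  (fun x _ => df x).
  by apply: derivable_within_continuous => x _; exact: ex_derive.
rewrite /f !fctE !cos_pow_prim0 subrr !subr0 -!/(wallis _) => h.
have pi1 : 0 <= cos c.
  by apply: cos_ge0_pihalf; move: cin; rewrite in_itv /= => /andP[]; lra.
rewrite -subr_ge0 h; apply: mulr_ge0 => //.
have -> : cos c ^+ n - cos c ^+ n.+1 = cos c ^+ n * (1 - cos c).
  by rewrite exprS; ring.
by rewrite mulr_ge0 ?exprn_ge0 // subr_ge0 cos_le1.
Qed.

Lemma wallis_prod n : n.+1%:R * wallis n.+1 * wallis n = pi / 2.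
Proof.
elim: n => [|n IH]; first by rewrite /wallis /= sin_pihalf !mul1r.
rewrite wallis_rec -IH.
have : n.+2%:R != 0 :> R by rewrite pnatr_eq0.
by move=> h; field.
Qed.

Lemma wallis_ge0 n : 0 <= wallis n.
Proof.
have [m] := ubnP n; elim: m n => // m IH [|[|n]] nm.
- by rewrite /wallis /= divr_ge0 // pi_ge0.
- by rewrite /wallis /= sin_pihalf.
- by rewrite wallis_rec mulr_ge0 // ?divr_ge0 // (IH n (ltnW nm)).
Qed.

End Wallis.

(** * The kernel at even sites: convergence and logarithmic growth *)

Section Kernel.
Context {R : realType}.
Implicit Types (i j : int) (k N m s : nat).
Local Notation lazyp := (@lazyp R).

(** Both sides obey the same recursion in k: [lazyp0S] and two steps of [wallis_rec]. *)
Lemma lazyp0_wallis k : lazyp k 0 * (pi / 2) = wallis k.*2.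
Proof.
elim: k => [|k IH]; first by rewrite /wallis /= mul1r.
rewrite lazyp0S doubleS wallis_rec -IH -natr1 -[k.*2.+1%:R]natr1 -mul2n natrM.
by field; have : 0 <= k%:R :> R by []; lra.
Qed.

(** W_(2k)^2 is at most W_(2k) W_(2k-1), which [wallis_prod] evaluates. The lower bound
    [lazyp0_sqr_ge] uses W_(2k) W_(2k+1) instead. *)
Lemma lazyp0_sqr_le k : (0 < k)%N -> lazyp k 0 ^+ 2 <= (pi * k%:R)^-1.
Proof.
case: k => // k _; have pi0 := pi_gt0 R.
have k0 : 0 <= k%:R :> R by [].
have h1 := @wallis_decr R k.*2.+1; have h2 := @wallis_prod R k.*2.+1.
have h3 := @wallis_ge0 R k.*2.+2; have e := lazyp0_wallis k.+1.
move: h1 h2 h3 e; rewrite doubleS => h1 h2 h3 e.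
have -> : lazyp k.+1 0 = wallis k.*2.+2 * 2 / pi by rewrite -e; field; lra.
rewrite -[(pi * _)^-1]mul1r ler_pdivlMr; last by rewrite mulr_gt0 ?ltr0n.
have : k.*2.+2%:R * wallis k.*2.+2 * wallis k.*2.+2 <= pi / 2 :> R.
  by rewrite -h2 ler_wpM2l // mulr_ge0.
have -> : k.*2.+2%:R = 2 * k.+1%:R :> R by rewrite -natrM mul2n doubleS.
move=> h.
have -> : (wallis k.*2.+2 * 2 / pi) ^+ 2 * (pi * k.+1%:R) =
  (2 * k.+1%:R * wallis k.*2.+2 * wallis k.*2.+2) * (2 / pi) :> R.
  by field; lra.
by rewrite mulrA ler_pdivrMr // mul1r; lra.
Qed.

Lemma lazyp0_sqr_ge k : (pi * k.+1%:R)^-1 <= lazyp k 0 ^+ 2.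
Proof.
have pi0 := pi_gt0 R.
have k0 : 0 <= k%:R :> R by [].
have h1 := @wallis_decr R k.*2; have h2 := @wallis_prod R k.*2.
have h3 := @wallis_ge0 R k.*2; have e := lazyp0_wallis k.
have -> : lazyp k 0 = wallis k.*2 * 2 / pi by rewrite -e; field; lra.
rewrite -[(pi * _)^-1]mul1r ler_pdivrMr; last by rewrite mulr_gt0 ?ltr0n.
have : pi / 2 <= k.*2.+1%:R * wallis k.*2 * wallis k.*2 :> R.
  by rewrite -h2 ler_wpM2r // ler_wpM2l.
have -> : k.*2.+1%:R = 2 * k%:R + 1 :> R by rewrite -natr1 -mul2n natrM.
move=> h.
have -> : (wallis k.*2 * 2 / pi) ^+ 2 * (pi * k.+1%:R) =
  (2 * (k%:R + 1) * wallis k.*2 * wallis k.*2) * (2 / pi) :> R.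
  by rewrite -natr1; field; lra.
rewrite mulrA ler_pdivlMr // mul1r.
have : 0 <= wallis k.*2 * wallis k.*2 :> R by exact: mulr_ge0.
nra.
Qed.

Lemma lazyp0_sqr_kle k : lazyp k 0 ^+ 2 * k%:R <= pi^-1.
Proof.
have pi0 := pi_gt0 R.
case: k => [|k]; first by rewrite mulr0 invr_ge0 ltW.
have := @lazyp0_sqr_le _ (ltn0Sn k).
rewrite -(@ler_pM2r _ k.+1%:R) ?ltr0n // => /le_trans; apply.
have : 0 < k.+1%:R :> R by rewrite ltr0n.
by move: (k.+1%:R) => K K0; rewrite le_eqVlt; apply/orP; left; apply/eqP; field; lra.
Qed.

(** b_k(i) b_k(j) is the probability that the planar walk from 0 is at (i + j, i - j) after 2k
    steps. *)
Definition pk_term k i j : R := lazyp k 0 ^+ 2 - lazyp k i * lazyp k j.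
Definition pk_sum N i j : R := \sum_(0 <= k < N) pk_term k i j.

Lemma pk_term_ge0 k i j : 0 <= pk_term k i j.
Proof.
by rewrite subr_ge0 expr2 ler_pM ?lazyp_ge0 ?lazyp_le0.
Qed.

Lemma pk_term_le k i j : pk_term k i j <= lazyp k 0 ^+ 2.
Proof. by rewrite gerBl mulr_ge0 ?lazyp_ge0. Qed.

(** Gives order (i^2 + j^2)/k^2, hence a summable tail. [pk_term_ge] treats the opposite range,
    where the term is close to b_k(0)^2. *)
Lemma pk_term_le_sqr k i j : (0 < k)%N ->
  pk_term k i j <= lazyp k 0 ^+ 2 * (i%:~R ^+ 2 + j%:~R ^+ 2) / k%:R.
Proof.
move=> k0; have hi := @lazyp_ge R k i k0; have hj := @lazyp_ge R k j k0.
have k0' : 0 < k%:R :> R by rewrite ltr0n.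
have bi0 := @lazyp_ge0 R k i; have bi := @lazyp_le0 R k i.
have b0 := @lazyp_ge0 R k 0.
rewrite -mulrA mulrDl /pk_term.
have : 0 <= (i%:~R : R) ^+ 2 / k%:R by rewrite divr_ge0 ?sqr_ge0 ?ltW.
have : 0 <= (j%:~R : R) ^+ 2 / k%:R by rewrite divr_ge0 ?sqr_ge0 ?ltW.
move: hi hj bi0 bi b0.
move: (i%:~R ^+ 2 / _) => x; move: (j%:~R ^+ 2 / _) => y.
move: (lazyp k 0) (lazyp k i) (lazyp k j) => b bi bj h1 h2 h3 h4 h5 y0 x0.
have e1 : b * (b - bi) <= b * (b * x) by apply: ler_wpM2l; lra.
have e2 : bi * (b - bj) <= b * (b * y).
  apply: le_trans (_ : bi * (b * y) <= _).
    by apply: ler_wpM2l; lra.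
  by apply: ler_wpM2r; rewrite ?mulr_ge0.
lra.
Qed.

Lemma pk_term_ge k i j :
  (lazyp k 0 ^+ 2) * (i%:~R ^+ 2 + j%:~R ^+ 2 - 4 * k%:R) <=
  pk_term k i j * (i%:~R ^+ 2 + j%:~R ^+ 2).
Proof.
have hi := @lazyp_sqr_le R k i; have hj := @lazyp_sqr_le R k j.
have bi0 := @lazyp_ge0 R k i; have bi := @lazyp_le0 R k i.
have bj0 := @lazyp_ge0 R k j; have bj := @lazyp_le0 R k j.
have b0 := @lazyp_ge0 R k 0.
have k0 : 0 <= k%:R :> R by [].
rewrite /pk_term; move: hi hj bi0 bi bj0 bj b0 k0.
move: (lazyp k 0) (lazyp k i) (lazyp k j) => b bi bj.
move: (k%:R) (i%:~R ^+ 2) (j%:~R ^+ 2) => K x y hi hj h1 h2 h3 h4 h5 h6.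
have e1 : bj * (bi * x) <= b * (2 * K * b).
  apply: le_trans (_ : bj * (2 * K * b) <= _); first exact: ler_wpM2l.
  by apply: ler_wpM2r => //; rewrite !mulr_ge0.
have e2 : bi * (bj * y) <= b * (2 * K * b).
  apply: le_trans (_ : bi * (2 * K * b) <= _); first exact: ler_wpM2l.
  by apply: ler_wpM2r => //; rewrite !mulr_ge0.
nra.
Qed.

Lemma inv_le_lnB N : (N.+2%:R)^-1 <= ln N.+2%:R - ln N.+1%:R :> R.
Proof.
rewrite -ln_div ?posrE ?ltr0n //; rewrite -lerN2 -lnV ?posrE ?divr_gt0 ?ltr0n //.
have N0 : 0 <= N%:R :> R by [].
have -> : (N.+2%:R / N.+1%:R)^-1 = 1 + - (N.+2%:R)^-1 :> R.
  by rewrite -[N.+2%:R]natr1 -natr1; field; lra.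
apply: le_ln1Dx; rewrite ltrN2 invf_lt1 ?ltr0n //.
by rewrite ltr1n.
Qed.

Lemma lnB_le_inv N : ln N.+2%:R - ln N.+1%:R <= (N.+1%:R)^-1 :> R.
Proof.
rewrite -ln_div ?posrE ?ltr0n //.
have -> : N.+2%:R / N.+1%:R = 1 + (N.+1%:R)^-1 :> R.
  have N0 : 0 <= N%:R :> R by [].
  by rewrite -[N.+2%:R]natr1 -natr1; field; lra.
apply: le_ln1Dx; apply: lt_le_trans (_ : 0 <= _); first by rewrite ltrN10.
by rewrite invr_ge0.
Qed.

Lemma pk_sum_le_ln N i j : pk_sum N.+2 i j <= 1 + (1 + ln N.+1%:R) / pi.
Proof.
have pi0 := pi_gt0 R.
elim: N => [|N IH]; rewrite /pk_sum big_nat_recr //=.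
  rewrite big_nat1 ln1 addr0; apply: lerD.
    apply: le_trans (pk_term_le _ _ _) _.
    by rewrite expr1n.
  apply: le_trans (pk_term_le _ _ _) _.
  by have := @lazyp0_sqr_le _ (ltn0Sn 0); rewrite mulr1 mul1r.
apply: le_trans (lerD IH (pk_term_le _ _ _)) _.
apply: le_trans (lerD (lexx _) (@lazyp0_sqr_le _ (ltn0Sn _))) _.
have ip : 0 < pi^-1 :> R by rewrite invr_gt0.
have := inv_le_lnB N; rewrite -(ler_pM2r ip) invfM.
move: (pi^-1) (N.+2%:R^-1) => c x; lra.
Qed.

(** [s] is the diffusive time. Up to it the terms are at most 1/(pi k) and add up to a logarithm;
    beyond it they are at most s/(pi k^2), below s/(pi k (k - 1)), which telescopes to the last
    summand. *)
Lemma pk_sum_le_far i j s m : s = (1 + `|i| ^ 2 + `|j| ^ 2)%N ->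
  pk_sum (s.+1 + m)%N i j <=
    1 + (1 + ln s%:R) / pi + pi^-1 * (1 - s%:R / (s + m)%:R).
Proof.
move=> es; have pi0 := pi_gt0 R.
have s0 : (0 < s)%N by rewrite es.
have s0' : 0 < s%:R :> R by rewrite ltr0n.
elim: m => [|m IH].
  rewrite !addn0 divff ?gt_eqF // subrr mulr0 addr0.
  by case: s s0 {es s0'} => // s _; exact: pk_sum_le_ln.
rewrite !addnS /pk_sum big_nat_recr //=.
apply: le_trans (lerD IH (@pk_term_le_sqr (s.+1 + m)%N i j isT)) _.
rewrite -addrA lerD2l.
set k := (s.+1 + m)%N; have ek : (s + m).+1 = k by rewrite /k addSn.
clearbody k.
have sm0 : 0 < (s + m)%:R :> R by rewrite ltr0n addn_gt0 s0.
have k0 : 0 < k%:R :> R by rewrite ltr0n -ek.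
have ekR : k%:R = (s + m)%:R + 1 :> R by rewrite -ek natr1.
have le1 : lazyp k 0 ^+ 2 * (i%:~R ^+ 2 + j%:~R ^+ 2) / k%:R <=
   (pi * k%:R)^-1 * s%:R / k%:R.
  apply: ler_wpM2r; first by rewrite invr_ge0 ltW.
  apply: ler_pM; rewrite ?exprn_ge0 ?lazyp_ge0 ?addr_ge0 ?sqr_ge0 //.
    by apply: lazyp0_sqr_le; rewrite -ek.
  by rewrite es !natrD !natrX !sqr_absz_intr -addrA lerDr.
apply: le_trans (lerD (lexx _) le1) _.
have -> : (pi * k%:R)^-1 * s%:R / k%:R = pi^-1 * (s%:R / (k%:R * k%:R)) :> R.
  by clear - k0 pi0; field; lra.
rewrite -mulrDr ler_pM2l ?invr_gt0 // ek.
rewrite -subr_ge0.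
have -> : 1 - s%:R / k%:R - (1 - s%:R / (s + m)%:R + s%:R / (k%:R * k%:R)) =
   s%:R / ((s + m)%:R * k%:R * k%:R) :> R.
  by clear - sm0 k0 ekR; rewrite ekR; field; lra.
by rewrite divr_ge0 ?mulr_ge0 // ltW.
Qed.

Lemma pk_sum_ndecr i j : nondecreasing_seq (fun N => pk_sum N i j).
Proof.
apply/nondecreasing_seqP => N; rewrite /pk_sum big_nat_recr //= lerDl.
exact: pk_term_ge0.
Qed.

Definition normsq i j : nat := (`|i| ^ 2 + `|j| ^ 2)%N.

Lemma pk_sum_le N i j :
  pk_sum N i j <= 1 + (2 + ln (1 + normsq i j)%:R) / pi.
Proof.
have pi0 := pi_gt0 R.
set s := (1 + _)%N.
apply: le_trans (_ : pk_sum (s.+1 + N)%N i j <= _).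
  by apply: (pk_sum_ndecr i j); rewrite leq_addl.
have es : s = (1 + `|i| ^ 2 + `|j| ^ 2)%N by rewrite -addnA.
apply: le_trans (pk_sum_le_far N es) _.
have : 0 <= pi^-1 * (s%:R / (s + N)%:R) :> R.
  by rewrite mulr_ge0 ?divr_ge0 // invr_ge0 ltW.
lra.
Qed.

Definition pk_even i j : R := limn (fun N => pk_sum N i j).

Lemma cvg_pk_sum i j : (fun N => pk_sum N i j) @ \oo --> pk_even i j.
Proof.
apply: nondecreasing_is_cvgn; first exact: pk_sum_ndecr.
by eexists => _ [N _ <-]; exact: pk_sum_le.
Qed.

Lemma pk_even_le i j : pk_even i j <= 1 + (2 + ln (1 + normsq i j)%:R) / pi.
Proof.
apply: limr_le; first by apply: cvgP; exact: cvg_pk_sum.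
by apply: nearW => N; exact: pk_sum_le.
Qed.

Lemma pk_sum_le_even N i j : pk_sum N i j <= pk_even i j.
Proof.
apply: (nondecreasing_cvgn_le (pk_sum_ndecr i j)).
by apply: cvgP; exact: cvg_pk_sum.
Qed.

(** Only the first r = i^2 + j^2 terms are kept. Each is at least (1/pi)(1/(k + 1) - 4/r): the
    harmonic sum gives the logarithm and the corrections total 4/pi. *)
Lemma pk_even_ge i j : (ln (1 + normsq i j)%:R - 4) / pi <= pk_even i j.
Proof.
have pi0 := pi_gt0 R; have ipi0 : 0 < pi^-1 :> R by rewrite invr_gt0.
have [r0|r0] := posnP (normsq i j).
  rewrite r0 ln1; apply: le_trans (pk_sum_le_even 0 i j).
  by rewrite /pk_sum big_geq //; nra.
apply: le_trans (pk_sum_le_even (normsq i j) i j).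
set r := normsq i j in r0 *.
have er : r%:R = i%:~R ^+ 2 + j%:~R ^+ 2 :> R.
  by rewrite /r natrD !natrX !sqr_absz_intr.
have r0' : 0 < r%:R :> R by rewrite ltr0n.
have termB k : (pi^-1) * ((k.+1%:R)^-1 - 4 / r%:R) <= pk_term k i j.
  have h := pk_term_ge k i j; rewrite -er in h.
  have h2 := lazyp0_sqr_ge k; have h3 := lazyp0_sqr_kle k.
  rewrite -(ler_pM2r r0'); apply: le_trans h.
  have -> : pi^-1 * ((k.+1%:R)^-1 - 4 / r%:R) * r%:R =
      (pi * k.+1%:R)^-1 * r%:R - 4 * pi^-1 :> R.
    have : 0 < k.+1%:R :> R by rewrite ltr0n.
    by move: (k.+1%:R) => K K0; clear - K0 r0' pi0; field; lra.
  have lin (x p b u v : R) : b * v <= p -> x <= b * u -> x - 4 * p <= b * (u - 4 * v).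
    by lra.
  by apply: lin => //; rewrite ler_pM2r.
apply: le_trans (_ : \sum_(0 <= k < r) pi^-1 * ((k.+1%:R)^-1 - 4 / r%:R) <= _);
  last by apply: ler_sum => k _; exact: termB.
rewrite -mulr_sumr [leLHS]mulrC ler_pM2l // sumrB sumr_const_nat subn0.
have -> : (4 / r%:R) *+ r = 4 :> R by rewrite -mulr_natr divfK ?gt_eqF.
rewrite lerD2r add1n.
elim: (r) => [|n IH]; first by rewrite big_geq // ln1.
rewrite big_nat_recr //= addrC; have := lnB_le_inv n; rewrite lerBlDr => h.
by apply: le_trans h _; rewrite lerD2l.
Qed.

Lemma cvg_lazyp_prod i j : (fun N => lazyp N i * lazyp N j) @ \oo --> (0 : R).
Proof.
have pi0 := pi_gt0 R.
rewrite -(@cvg_shiftS _ ).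
apply: (@squeeze_cvgr _ _ _ _ (cst 0) (fun n => pi^-1 * (n.+1%:R)^-1)).
- apply: nearW => N; apply/andP; split.
    by apply: mulr_ge0; exact: lazyp_ge0.
  apply: le_trans (_ : lazyp N.+1 0 ^+ 2 <= _).
    by rewrite expr2; apply: ler_pM; rewrite ?lazyp_ge0 ?lazyp_le0.
  by rewrite -invfM; exact: lazyp0_sqr_le.
- exact: cvg_cst.
- rewrite -[X in _ --> X](mulr0 (pi^-1)); apply: cvgMr; exact: cvg_harmonic.
Qed.

End Kernel.

(** * The kernel on the whole lattice *)

Section Potential.
Context {R : realType}.
Implicit Types (i j : int) (z : Z2).
Local Notation e := (@pk_even R).

Lemma pk_evenNl i j : e (- i) j = e i j.
Proof.
rewrite /pk_even; congr (limn _); apply/funext => N; apply: eq_bigr => k _.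
by rewrite /pk_term lazypN.
Qed.

Lemma pk_evenNr i j : e i (- j) = e i j.
Proof.
rewrite /pk_even; congr (limn _); apply/funext => N; apply: eq_bigr => k _.
by rewrite /pk_term lazypN.
Qed.

Lemma pk_even_ge0 i j : 0 <= e i j.
Proof. by apply: le_trans (pk_sum_le_even 0 i j); rewrite /pk_sum big_geq. Qed.

Lemma pk_even00 : e 0 0 = 0.
Proof.
rewrite /pk_even (_ : (fun _ => _) = cst 0) ?lim_cst //.
apply/funext => N; rewrite /pk_sum big1 // => k _.
by rewrite /pk_term expr2 subrr.
Qed.

Definition lazy_avg2 (f : int -> int -> R) i j : R :=
  ((f (i - 1) (j - 1) + 2 * f (i - 1) j + f (i - 1) (j + 1)) +
   2 * (f i (j - 1) + 2 * f i j + f i (j + 1)) +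
   (f (i + 1) (j - 1) + 2 * f (i + 1) j + f (i + 1) (j + 1))) / 16.

(** Averaging turns b_k(i) b_k(j) into b_(k+1)(i) b_(k+1)(j), so the sum telescopes. The point mass
    is the product for k = 0; the one for k = N vanishes in the limit. *)
Lemma pk_sum_avg N i j : lazy_avg2 (pk_sum N) i j =
  pk_sum N i j + ((i == 0) && (j == 0))%:R - lazyp N i * lazyp N j.
Proof.
elim: N => [|N IH].
  have -> : lazyp 0 i * lazyp 0 j = ((i == 0) && (j == 0))%:R :> R.
    by rewrite -mulnb natrM.
  rewrite /lazy_avg2 /pk_sum !big_geq //.
  by rewrite addrK !(mulr0, addr0, mul0r).
have eS i' j' : pk_sum N.+1 i' j' = pk_sum N i' j' + @pk_term R N i' j'.
  by rewrite /pk_sum big_nat_recr.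
move: IH; rewrite /lazy_avg2 !eS /pk_term.
by rewrite [lazyp N.+1 i]/= [lazyp N.+1 j]/=; lra.
Qed.

Lemma pk_even_avg i j :
  lazy_avg2 e i j = e i j + ((i == 0) && (j == 0))%:R.
Proof.
have h1 : (fun N => lazy_avg2 (pk_sum N) i j) @ \oo --> lazy_avg2 e i j.
  have row i' : (fun N => pk_sum N i' (j - 1) + 2 * pk_sum N i' j +
      pk_sum N i' (j + 1)) @ \oo --> e i' (j - 1) + 2 * e i' j + e i' (j + 1).
    apply: cvgD; last exact: cvg_pk_sum.
    by apply: cvgD; last apply: cvgMr; exact: cvg_pk_sum.
  apply: cvgMl; apply: cvgD; last exact: row.
  by apply: cvgD; last apply: cvgMr; exact: row.
have h2 : (fun N => lazy_avg2 (pk_sum N) i j) @ \oo -->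
    e i j + ((i == 0) && (j == 0))%:R - 0.
  under eq_fun do rewrite pk_sum_avg.
  apply: cvgB; last exact: cvg_lazyp_prod.
  by apply: cvgD; [exact: cvg_pk_sum|exact: cvg_cst].
by rewrite -(cvg_lim _ h1) // (cvg_lim _ h2) // subr0.
Qed.

(** The value forced by harmonicity at the odd site (i + j + 1, i - j): the mean over its four even
    neighbours. *)
Definition pk_odd i j : R := (e i j + e (i + 1) j + e i (j + 1) + e (i + 1) (j + 1)) / 4.

(* Even sites are written (i + j, i - j): in these coordinates two steps of the
   walk are two independent lazy steps. *)
Definition pot z : R :=
  let i := ((z.1 + z.2) %/ 2)%Z in let j := ((z.1 - z.2) %/ 2)%Z in
  if ((z.1 + z.2) %% 2)%Z == 0 then e i j else pk_odd i j.

Lemma pot_even i j : pot (i + j, i - j) = e i j.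
Proof.
rewrite /pot /=.
have -> : ((i + j + (i - j)) %/ 2)%Z = i by lia.
have -> : ((i + j - (i - j)) %/ 2)%Z = j by lia.
by have -> : ((i + j + (i - j)) %% 2)%Z = 0 by lia.
Qed.

Lemma pot_odd i j : pot (i + j + 1, i - j) = pk_odd i j.
Proof.
rewrite /pot /=.
have -> : ((i + j + 1 + (i - j)) %/ 2)%Z = i by lia.
have -> : ((i + j + 1 - (i - j)) %/ 2)%Z = j by lia.
by have -> : ((i + j + 1 + (i - j)) %% 2)%Z = 1 by lia.
Qed.

Lemma Z2_parity z :
  exists i j, z = (i + j, i - j) \/ z = (i + j + 1, i - j).
Proof.
case: z => a b; exists ((a + b) %/ 2)%Z, ((a - b) %/ 2)%Z.
have [h|h] : ((a + b) %% 2)%Z = 0 \/ ((a + b) %% 2)%Z = 1 by lia.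
  by left; congr (_, _); lia.
by right; congr (_, _); lia.
Qed.

Definition avg4 (f : Z2 -> R) z : R := 4^-1 * \sum_(k < 4) f (addp z (step k)).

Lemma avg4E f z : avg4 f z = (f (z.1 + 1, z.2) + f (z.1 - 1, z.2) +
   f (z.1, z.2 + 1) + f (z.1, z.2 - 1)) / 4.
Proof.
rewrite /avg4 !big_ord_recl big_ord0 /addp /step /= !addr0.
by rewrite mulrC !addrA.
Qed.

Lemma pot0 : pot (0, 0) = 0.
Proof. by rewrite -[RHS]pk_even00 -pot_even. Qed.

(** At odd sites this is the definition of [pk_odd]. At even sites the average of four such averages
    is [lazy_avg2], so [pk_even_avg] applies. *)
Lemma pot_avg4 z : avg4 pot z = pot z + (z == (0, 0))%:R.
Proof.
have [i [j [->|->]]] := Z2_parity z; rewrite avg4E /=.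
  have -> : (i + j - 1, i - j) = ((i - 1) + (j - 1) + 1, (i - 1) - (j - 1)) :> Z2.
    by congr (_, _); lia.
  have -> : (i + j, i - j + 1) = (i + (j - 1) + 1, i - (j - 1)) :> Z2.
    by congr (_, _); lia.
  have -> : (i + j, i - j - 1) = ((i - 1) + j + 1, (i - 1) - j) :> Z2.
    by congr (_, _); lia.
  rewrite !pot_odd pot_even /pk_odd !subrK.
  have -> : ((i + j, i - j) == (0, 0) :> Z2) = (i == 0) && (j == 0).
    by rewrite xpair_eqE; lia.
  by rewrite -pk_even_avg /lazy_avg2; lra.
have -> : (i + j + 1 + 1, i - j) = ((i + 1) + (j + 1), (i + 1) - (j + 1)) :> Z2.
  by congr (_, _); lia.
have -> : (i + j + 1, i - j + 1) = ((i + 1) + j, (i + 1) - j) :> Z2.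
  by congr (_, _); lia.
have -> : (i + j + 1, i - j - 1) = (i + (j + 1), i - (j + 1)) :> Z2.
  by congr (_, _); lia.
rewrite addrK pot_odd !pot_even /pk_odd.
have -> : ((i + j + 1, i - j) == (0, 0) :> Z2) = false.
  by rewrite xpair_eqE; lia.
by rewrite addr0; lra.
Qed.

Lemma pot_ge0 z : 0 <= pot z.
Proof.
rewrite /pot; case: ifP => _; first exact: pk_even_ge0.
by rewrite /pk_odd divr_ge0 // !addr_ge0 // pk_even_ge0.
Qed.

Lemma potN z : pot (- z.1, - z.2) = pot z.
Proof.
have [i [j [->|->]]] /= := Z2_parity z.
  have -> : (- (i + j), - (i - j)) = (- i + - j, - i - - j) :> Z2.
    by congr (_, _); lia.
  by rewrite !pot_even pk_evenNl pk_evenNr.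
have -> : (- (i + j + 1), - (i - j)) =
    ((- (i + 1)) + (- (j + 1)) + 1, (- (i + 1)) - (- (j + 1))) :> Z2.
  by congr (_, _); lia.
rewrite !pot_odd /pk_odd.
have -> : - (i + 1) + 1 = - i by lia.
have -> : - (j + 1) + 1 = - j by lia.
by rewrite !pk_evenNl !pk_evenNr; lra.
Qed.

Definition sqnorm z : R := (z.1 ^+ 2 + z.2 ^+ 2)%:~R.

Lemma nsq_ge0 z : 0 <= sqnorm z.
Proof. by rewrite /sqnorm ler0z addr_ge0 ?sqr_ge0. Qed.

Lemma ln2_le1 : ln 2 <= 1 :> R.
Proof. by have := @le_ln1Dx R 1; rewrite -[1 + 1]/(2 : R); apply; lra. Qed.

Lemma nsq_even i j : sqnorm (i + j, i - j) = 2 * (normsq i j)%:R.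
Proof.
rewrite /sqnorm /normsq natrD !natrX -!sqr_absz_intr.
by rewrite !rmorphD /= !rmorphXn /= !rmorphD /= rmorphN /=; ring.
Qed.

Lemma pot_even_bound i j :
  `|e i j - ln (1 + sqnorm (i + j, i - j)) / pi| <= 3.
Proof.
rewrite nsq_even; have := @pk_even_le R i j; have := @pk_even_ge R i j.
rewrite natrD; set r := (normsq i j)%:R.
have r0 : 0 <= r by []; have pi2 := pi_ge2 R.
have pi0 : 0 < pi :> R by lra.
have ip : pi^-1 <= 2^-1 :> R by rewrite lef_pV2 ?posrE.
have ip0 : 0 < pi^-1 :> R by rewrite invr_gt0.
have h1 : ln (1 + r) <= ln (1 + 2 * r) by rewrite ler_ln ?posrE; lra.
have h2 : ln (1 + 2 * r) <= 1 + ln (1 + r).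
  apply: le_trans (_ : ln (2 * (1 + r)) <= _).
    by rewrite ler_ln ?posrE; lra.
  by rewrite lnM ?posrE; [rewrite lerD2r ln2_le1| lra | lra].
have h3 : 0 <= (ln (1 + 2 * r) - ln (1 + r)) * pi^-1.
  by apply: mulr_ge0; lra.
have h4 : 0 <= (1 + ln (1 + r) - ln (1 + 2 * r)) * pi^-1.
  by apply: mulr_ge0; lra.
move: h3 h4; move: (e i j) (ln (1 + r)) (ln (1 + 2 * r)) (pi^-1) ip ip0.
move=> E x y p p1 p2 h3 h4 h5 h6.
rewrite ler_norml; apply/andP; split; lra.
Qed.

(** The logarithm is (2/pi) log|z| made finite at 0. An odd site averages its even neighbours, where
    the error is at most 3; one step changes ln (1 + |z|^2) by at most 2, hence the quotient by pi
    by at most 1. *)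
Lemma pot_bound z : `|pot z - ln (1 + sqnorm z) / pi| <= 5.
Proof.
have [i [j [->|]]] := Z2_parity z.
  by rewrite pot_even; apply: le_trans (pot_even_bound i j) _; lra.
move=> ez; have z0 : z != (0, 0) by rewrite ez xpair_eqE; lia.
have := pot_avg4 z; rewrite (negbTE z0) addr0 => <-.
have pi2 := pi_ge2 R.
have pi0 : 0 < pi :> R by lra.
have ip : pi^-1 <= 2^-1 :> R by rewrite lef_pV2 ?posrE.
have ip0 : 0 < pi^-1 :> R by rewrite invr_gt0.
have l2 := ln2_le1.
have nb (w : Z2) i' j' : w = (i' + j', i' - j') ->
    sqnorm w <= 2 * sqnorm z + 2 -> sqnorm z <= 2 * sqnorm w + 2 ->
    `|pot w - ln (1 + sqnorm z) / pi| <= 5.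
  move=> -> ; rewrite pot_even => h1 h2.
  have := pot_even_bound i' j'.
  move: (nsq_ge0 (i' + j', i' - j')) (nsq_ge0 z) h1 h2.
  move: (sqnorm (i' + j', i' - j')) (sqnorm z) => a b a0 b0 h1 h2.
  have g (x y : R) : 0 <= x -> 0 <= y -> x <= 2 * y + 2 ->
      ln (1 + x) <= ln (1 + y) + 2.
    move=> x0 y0 xy; apply: le_trans (_ : ln (2 * 2 * (1 + y)) <= _).
      by rewrite ler_ln ?posrE; lra.
    rewrite lnM ?posrE; [|lra|lra].
    by rewrite lnM ?posrE //; lra.
  have := g a b a0 b0 h1; have := g b a b0 a0 h2.
  move: (e i' j') (ln (1 + a)) (ln (1 + b)) (pi^-1) ip ip0 => E x y p p1 p2 g1 g2.
  have e1 : 0 <= (x + 2 - y) * p by apply: mulr_ge0; lra.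
  have e2 : 0 <= (y + 2 - x) * p by apply: mulr_ge0; lra.
  by rewrite !ler_norml => /andP[h3 h4]; apply/andP; split; lra.
rewrite avg4E ez /=; rewrite ez in nb.
have sq (x y : int) : sqnorm (x, y) = x%:~R ^+ 2 + y%:~R ^+ 2.
  by rewrite /sqnorm rmorphD /= !rmorphXn.
have e1 : (i + j + 1 + 1, i - j) = ((i + 1) + (j + 1), (i + 1) - (j + 1)) :> Z2.
  by clear; congr (_, _); lia.
have e2 : (i + j + 1 - 1, i - j) = (i + j, i - j) :> Z2.
  by clear; congr (_, _); lia.
have e3 : (i + j + 1, i - j + 1) = ((i + 1) + j, (i + 1) - j) :> Z2.
  by clear; congr (_, _); lia.
have e4 : (i + j + 1, i - j - 1) = (i + (j + 1), i - (j + 1)) :> Z2.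
  by clear; congr (_, _); lia.
have n1 := nb _ _ _ e1; have n2 := nb _ _ _ e2.
have n3 := nb _ _ _ e3; have n4 := nb _ _ _ e4.
move: n1 n2 n3 n4; rewrite !sq.
move: (i + j + 1) (i - j) => a b; rewrite !rmorphD !rmorphN /=.
move: (a%:~R : R) (b%:~R : R) => A B n1 n2 n3 n4.
have q1 (t u v : R) : t ^+ 2 = 1 -> (u + t) ^+ 2 + v ^+ 2 <= 2 * (u ^+ 2 + v ^+ 2) + 2.
  by clear => t1; have := sqr_ge0 (u - t); have := sqr_ge0 v; lra.
have q2 (t u v : R) : t ^+ 2 = 1 -> u ^+ 2 + v ^+ 2 <= 2 * ((u + t) ^+ 2 + v ^+ 2) + 2.
  by clear => t1; have := sqr_ge0 (u + 2 * t); have := sqr_ge0 v; lra.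
have t1 : (1 : R) ^+ 2 = 1 by rewrite expr1n.
have t2 : (- 1 : R) ^+ 2 = 1 by rewrite sqrrN expr1n.
have {}n1 := n1 (q1 1 A B t1) (q2 1 A B t1).
have {}n2 := n2 (q1 (-1) A B t2) (q2 (-1) A B t2).
have {}n3 := n3 ltac:(rewrite ![A ^+ 2 + _]addrC; exact: q1)
  ltac:(rewrite ![A ^+ 2 + _]addrC; exact: q2).
have {}n4 := n4 ltac:(rewrite ![A ^+ 2 + _]addrC; exact: q1)
  ltac:(rewrite ![A ^+ 2 + _]addrC; exact: q2).
move: n1 n2 n3 n4; rewrite !ler_norml.
by move=> /andP[? ?] /andP[? ?] /andP[? ?] /andP[? ?]; apply/andP; split; lra.
Qed.

End Potential.

(** * Reduction to hitting functions *)

Section Walk.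
Context {R : realType}.
Implicit Types (w x y z : Z2) (s : seq 'I_4) (n N i j m : nat).

Definition inb n z : bool := z.1 ^+ 2 + z.2 ^+ 2 <= n%:Z ^+ 2.

Lemma inD_inb n z : inD (0, 0) (n%:R : R) z = inb n z.
Proof.
rewrite /inD /d /dist2 /inb /= !sub0r !sqrrN.
rewrite -[n%:R]ger0_norm // -sqrtr_sqr ler_sqrt ?sqr_ge0 //.
have -> : (n%:R : R) ^+ 2 = (n%:Z ^+ 2)%:~R by rewrite rmorphXn.
by rewrite ler_int.
Qed.

Lemma inb_step n w k : inb n w -> inb n.+1 (addp w (step k)).
Proof.
case: w => a b; rewrite /inb /addp /=.
rewrite (_ : n.+1%:Z = n%:Z + 1); last by lia.
have n0 : 0 <= n%:Z by [].
move: n%:Z n0 => c c0 h.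
have ha : - c <= a by nia.
have ha' : a <= c by nia.
have hb : - c <= b by nia.
have hb' : b <= c by nia.
by rewrite /step; case: k => -[|[|[|k]]] kp /=; nia.
Qed.

Lemma d_eq1 x y : (d x y = 1 :> R) <-> dist2 x y = 1.
Proof.
have d0 : 0 <= dist2 x y by rewrite /dist2 addr_ge0 ?sqr_ge0.
rewrite /d; split=> [h|->]; last by rewrite sqrtr1.
have : Num.sqrt ((dist2 x y)%:~R : R) ^+ 2 = 1 by rewrite h expr1n.
rewrite sqr_sqrtr ?ler0z // -[1]/(1%:~R) => /eqP.
by rewrite eqr_int => /eqP.
Qed.

Lemma dist2_step w k : dist2 w (addp w (step k)) = 1.
Proof.
case: w => a b; rewrite /dist2 /addp /step.
by case: k => -[|[|[|k]]] kp /=; lia.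
Qed.

(** Like [visits], this recurses on the first letter and moves the starting point, which matches
    first-step analysis. *)
Fixpoint exits n w s : bool :=
  if s is k :: s' then inb n w && exits n (addp w (step k)) s' else ~~ inb n w.

Fixpoint visits x w s : nat :=
  (w == x) + (if s is k :: s' then visits x (addp w (step k)) s' else 0).

Definition pos_from w s i : Z2 := foldl (fun p k => addp p (step k)) w (take i s).

Lemma exitsP n w s : exits n w s <->
  (forall i, (i < size s)%N -> inb n (pos_from w s i)) /\
  ~~ inb n (pos_from w s (size s)).
Proof.
elim: s w => [|k s IH] w /=; first by split => [h|[_ h]]; [split|exact: h].
split=> [/andP[hw /IH[h1 h2]]|[h1 h2]].
  by split => // -[|i] hi //; exact: h1.
apply/andP; split; first exact: (h1 0%N).
by apply/IH; split => // i hi; exact: (h1 i.+1).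
Qed.

Lemma pos_fromS w s i : (i < size s)%N -> exists k,
  pos_from w s i.+1 = addp (pos_from w s i) (step k).
Proof.
move=> hi; exists (nth ord0 s i).
by rewrite /pos_from (take_nth ord0) // -cats1 foldl_cat.
Qed.

(** A step has length 1, so the first site outside the disc lies in its outer boundary: hitting the
    boundary and leaving the disc happen at the same time. *)
Lemma firstHitE n s : firstHit R n s <-> exits n (0, 0) s.
Proof.
have i0 : inb n (0, 0) by rewrite /inb /= expr0n addr0 sqr_ge0.
have BdP z : inBd (R := R) n z -> ~~ inb n z by case; rewrite inD_inb.
have stepP i : (i < size s)%N -> inb n (pos s i) -> ~~ inb n (pos s i.+1) ->
    inBd (R := R) n (pos s i.+1).
  move=> hi hin hout; split; first by rewrite inD_inb.
  exists (pos s i); rewrite inD_inb; split => //; apply/d_eq1.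
  have [k ek] := pos_fromS (0, 0) hi.
  have {}ek : pos s i.+1 = addp (pos s i) (step k) by exact: ek.
  by rewrite ek dist2_step.
split=> [[h1 h2]|/exitsP[h1 h2]].
  apply/exitsP; split; last exact: BdP.
  elim=> [|i IH] hi; first by rewrite /pos_from take0.
  have hi' := ltnW hi; apply/negPn/negP => hout.
  exact: (h2 i.+1 hi (stepP i hi' (IH hi') hout)).
split; last by move=> i hi /BdP; rewrite h1.
case: (posnP (size s)) => [s0|sp].
  by move: h2; rewrite s0 /pos_from take0 => /negP; case.
rewrite -(prednK sp); apply: stepP; rewrite ?prednK //.
by apply: h1; rewrite prednK.
Qed.

Lemma K_visits s x : K s (size s) x = visits x (0, 0) s.
Proof.
rewrite /K.
suff H w : count (fun i => pos_from w s i == x) (iota 0 (size s).+1) = visits x w s.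
  exact: H.
elim: s w => [|k s IH] w; first by rewrite /= addn0.
have -> : iota 0 (size (k :: s)).+1 = 0%N :: map S (iota 0 (size s).+1).
  by rewrite -(iotaDl 1 0).
rewrite [LHS]/= [RHS]/= -IH count_map.
by congr (_ + _)%N.
Qed.

(* Probability that the walk from [w] leaves the disc D(0, n) within [N] steps after
   at least [i] visits to [x] and [j] visits to [y]. *)
Fixpoint pu n x y N i j w : R :=
  if inb n w then
    if N is N'.+1 then avg4 (pu n x y N' (i - (w == x)) (j - (w == y))) w else 0
  else ((i == 0%N) && (j == 0%N))%:R.

Lemma sum_tupleS m (F : seq 'I_4 -> R) :
  \sum_(t : m.+1.-tuple 'I_4) F (tval t) =
  \sum_(k < 4) \sum_(t : m.-tuple 'I_4) F (k :: tval t).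
Proof.
rewrite pair_big /=.
rewrite (reindex (fun p : 'I_4 * m.-tuple 'I_4 => [tuple of p.1 :: p.2])) //=.
exists (fun t : m.+1.-tuple 'I_4 => (thead t, [tuple of behead t])).
  by move=> [k t] _ /=; congr (_, _); apply/val_inj.
by move=> t _ /=; rewrite [RHS]tuple_eta.
Qed.

Definition good_path n x y i j w s : bool :=
  [&& exits n w s, (i <= visits x w s)%N & (j <= visits y w s)%N].

Lemma pu_sum n x y N i j w : inb n x -> inb n y ->
  \sum_(0 <= m < N.+1) (4 : R)^-1 ^+ m *
     \sum_(t : m.-tuple 'I_4) (good_path n x y i j w t)%:R = pu n x y N i j w.
Proof.
move=> hx hy.
have base i' j' w' : 4^-1 ^+ 0 *
    \sum_(t : 0.-tuple 'I_4) (good_path n x y i' j' w' t)%:R =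
    if inb n w' then 0 else ((i' == 0%N) && (j' == 0%N))%:R :> R.
  rewrite expr0 mul1r (big_pred1 [tuple]); last by move=> t; apply/esym/eqP; exact: tuple0.
  rewrite /good_path /= !addn0; case: ifPn => //= hw.
  (* [visits] counts the final position too; that one is outside the disc, hence different from x
     and y. *)
  have -> : (w' == x) = false by apply: contraNF hw => /eqP->.
  have -> : (w' == y) = false by apply: contraNF hw => /eqP->.
  by rewrite !leqn0.
elim: N i j w => [|N IH] i j w.
  by rewrite big_nat1 base /=.
rewrite big_nat_recl // base /=.
case: ifPn => hw; last first.
  rewrite big1 ?addr0 // => m _; rewrite (sum_tupleS _ (fun s => (good_path n x y i j w s)%:R)).
  rewrite big1 ?mulr0 // => k _.
  by rewrite big1 // => t _; rewrite /good_path /= (negbTE hw).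
rewrite add0r /avg4.
under [in RHS]eq_bigr do rewrite -IH.
rewrite exchange_big mulr_sumr; apply: eq_bigr => m _.
rewrite (sum_tupleS _ (fun s => (good_path n x y i j w s)%:R)) exprS -mulrA.
congr (_ * _); rewrite -mulr_sumr; congr (_ * _); apply: eq_bigr => k _; apply: eq_bigr => t _.
rewrite /good_path /= hw !leq_subLR.
by [].
Qed.

Lemma pu_ge0 n x y N i j w : 0 <= pu n x y N i j w.
Proof.
elim: N i j w => [|N IH] i j w /=; first by case: ifP.
by case: ifP => // _; rewrite avg4E divr_ge0 // !addr_ge0.
Qed.

Lemma pu_le1 n x y N i j w : pu n x y N i j w <= 1.
Proof.
elim: N i j w => [|N IH] i j w /=.
  by case: ifP => // _; case: (_ && _).
case: ifP => // _; last by case: (_ && _).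
rewrite avg4E.
have h a := IH (i - (w == x))%N (j - (w == y))%N a.
have := h (w.1 + 1, w.2); have := h (w.1 - 1, w.2).
have := h (w.1, w.2 + 1); have := h (w.1, w.2 - 1); lra.
Qed.

Lemma avg4_le (f g : Z2 -> R) w :
  (forall k, f (addp w (step k)) <= g (addp w (step k))) -> avg4 f w <= avg4 g w.
Proof.
by move=> h; rewrite /avg4 ler_pM2l ?invr_gt0 //; apply: ler_sum => k _; exact: h.
Qed.

Lemma pu_ndecr n x y i j w : nondecreasing_seq (fun N => pu n x y N i j w).
Proof.
apply/nondecreasing_seqP => N; elim: N i j w => [|N IH] i j w.
  rewrite [leLHS]/=; case: (boolP (inb n w)) => hw; first exact: pu_ge0.
  by rewrite /= (negbTE hw).
rewrite /=; case: ifP => // _; apply: avg4_le => k; exact: IH.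
Qed.

(* P(K(tau_n, x) >= T, K(tau_n, y) >= T) for the walk started at the origin. *)
Definition plim n x y T : R := limn (fun N => pu n x y N T T (0, 0)).

Lemma cvg_pu n x y T : (fun N => pu n x y N T T (0, 0)) @ \oo --> plim n x y T.
Proof.
apply: nondecreasing_is_cvgn; first exact: pu_ndecr.
by exists 1 => _ [N _ <-]; exact: pu_le1.
Qed.

(** For each N the sums over lengths, step sequences and sites are finite and may be exchanged; the
    limit is then taken inside the sum over the box. *)
Lemma Epairs_plim (alpha beta : R) n : 0 < alpha ->
  let T := `|Num.ceil (4 * alpha / pi * (ln (n%:R : R)) ^+ 2)|%N in
  Epairs alpha beta n =
  \sum_(x <- box n) \sum_(y <- box n)
    [&& inb n x, inb n y & d x y <= (n%:R : R) `^ beta]%:R * plim n x y T.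
Proof.
move=> a0 T.
have eT : Num.ceil (4 * alpha / pi * (ln (n%:R : R)) ^+ 2) = T%:Z.
  rewrite /T gez0_abs // ceil_ge0; apply: lt_le_trans (_ : 0 <= _).
    by rewrite ltrN10.
  by rewrite mulr_ge0 ?sqr_ge0 // divr_ge0 ?pi_ge0 // mulr_ge0 // ltW.
have part N : \sum_(0 <= m < N.+1)
    ((4 : R)^-1 ^+ m *
     \sum_(t : m.-tuple 'I_4 | `[< firstHit R n (tval t) >])
        (pairCount alpha beta n (tval t))%:R) =
   \sum_(x <- box n) \sum_(y <- box n)
    [&& inb n x, inb n y & d x y <= (n%:R : R) `^ beta]%:R * pu n x y N T T (0, 0).
  transitivity (\sum_(0 <= m < N.+1) \sum_(x <- box n) \sum_(y <- box n)
    [&& inb n x, inb n y & d x y <= (n%:R : R) `^ beta]%:R *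
    ((4 : R)^-1 ^+ m * \sum_(t : m.-tuple 'I_4) (good_path n x y T T (0, 0) t)%:R)).
    apply: eq_bigr => m _.
    rewrite big_mkcond /=.
    transitivity ((4 : R)^-1 ^+ m * \sum_(t : m.-tuple 'I_4) \sum_(x <- box n) \sum_(y <- box n)
       [&& inb n x, inb n y & d x y <= (n%:R : R) `^ beta]%:R *
       (good_path n x y T T (0, 0) t)%:R).
      congr (_ * _); apply: eq_bigr => t _.
      rewrite /pairCount natr_sum.
      have -> : `[< firstHit R n t >] = exits n (0, 0) t.
        by apply/asboolP/idP => /firstHitE.
      case: ifPn => he; last first.
        rewrite big1 // => x _; rewrite big1 // => y _.
        by rewrite /good_path (negbTE he) mulr0.
      apply: eq_bigr => x _; rewrite natr_sum; apply: eq_bigr => y _.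
      rewrite /good_path he -natrM mulnb /inPsi !inD_inb eT !lez_nat !K_visits.
      congr (_%:R); rewrite andTb.
      case: (inb n x) => //; case: (inb n y); last by rewrite andbF.
      by rewrite !andTb; case: (d x y <= _); rewrite ?andbT ?andbF.
    rewrite exchange_big mulr_sumr; apply: eq_bigr => x _.
    rewrite exchange_big mulr_sumr; apply: eq_bigr => y _.
    by rewrite -mulr_sumr mulrCA.
  rewrite exchange_big; apply: eq_bigr => x _.
  rewrite exchange_big; apply: eq_bigr => y _.
  rewrite -mulr_sumr; case: (boolP (inb n x)) => hx; last by rewrite !mul0r.
  case: (boolP (inb n y)) => hy; last by rewrite !mul0r.
  by rewrite pu_sum.
rewrite /Epairs; apply: cvg_lim => //.
rewrite -cvg_shiftS /=; under eq_fun do rewrite part.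
apply: cvg_big => [|x _]; first exact: add_continuous.
apply: cvg_big => [|y _]; first exact: add_continuous.
apply: cvgMr; exact: cvg_pu.
Qed.
End Walk.

(** * Comparison with superharmonic and subharmonic functions *)

Section Comparison.
Context {R : realType}.
Implicit Types (w x y z : Z2) (n N i j m : nat) (H : Z2 -> R).

Lemma avg4Z c H w : avg4 (fun v => c * H v) w = c * avg4 H w.
Proof. by rewrite !avg4E; lra. Qed.

Lemma avg4C c w : avg4 (fun _ => c) w = c :> R.
Proof. by rewrite avg4E; lra. Qed.

Lemma inbW n w : inb n w -> inb n.+1 w.
Proof.
rewrite /inb => /le_trans; apply.
by rewrite (_ : n.+1%:Z = n%:Z + 1); [have : 0 <= n%:Z by []; nia | lia].
Qed.

(** A supermartingale argument: [H] does not grow on average off {x, y}, and every visit that counts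
    is charged a factor [lam]. If x = y one visit counts twice, whence the power of [lam]. *)
Lemma pu_upper n x y H lam N i j w : 0 <= lam <= 1 ->
  (forall z, inb n.+1 z -> 0 <= H z) ->
  (forall z, inb n z -> z != x -> z != y -> avg4 H z <= H z) ->
  (forall z, inb n z -> (z == x) || (z == y) ->
     1 <= H z /\ avg4 H z <= lam ^+ ((z == x) + (z == y))) ->
  (0 < i + j)%N -> inb n.+1 w ->
  pu n x y N i j w <= lam ^+ (i + j - 2) * H w.
Proof.
move=> /andP[l0 l1] H0 Hharm Hxy.
elim: N i j w => [|N IH] i j w ij hw.
  rewrite /=; case: ifP => _; first by rewrite mulr_ge0 ?exprn_ge0 ?H0.
  case: eqP => [i0|_]; last by rewrite mulr_ge0 ?exprn_ge0 ?H0.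
  case: eqP => [j0|_]; last by rewrite mulr_ge0 ?exprn_ge0 ?H0.
  by move: ij; rewrite i0 j0.
rewrite /=; case: ifPn => hin; last first.
  case: eqP => [i0|_]; last by rewrite mulr_ge0 ?exprn_ge0 ?H0.
  case: eqP => [j0|_]; last by rewrite mulr_ge0 ?exprn_ge0 ?H0.
  by move: ij; rewrite i0 j0.
have step i' j' : (0 < i' + j')%N -> avg4 (pu n x y N i' j') w <=
    lam ^+ (i' + j' - 2) * avg4 H w.
  move=> h; rewrite -avg4Z; apply: avg4_le => k; apply: IH => //.
  exact: inb_step.
have [/norP[wx wy]|wxy] := boolP (~~ ((w == x) || (w == y))).
  rewrite (negbTE wx) (negbTE wy) !subn0.
  apply: le_trans (step _ _ ij) _.
  by rewrite ler_wpM2l ?exprn_ge0 ?Hharm.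
rewrite negbK in wxy.
have [H1 Hlam] := Hxy _ hin wxy.
set c := ((w == x) + (w == y))%N in Hlam.
have c2 : (c <= 2)%N by rewrite /c; case: (w == x); case: (w == y).
(* If the present visit completes the requirement, then i + j is at most 2 and the trivial bound 1
   <= H suffices; this is the origin of the exponent i + j - 2. *)
have [ij'|ij'] := posnP (i - (w == x) + (j - (w == y))).
  apply: le_trans (_ : 1 <= _).
    by rewrite -[leRHS](avg4C 1 w); apply: avg4_le => k; exact: pu_le1.
  have -> : (i + j - 2 = 0)%N by rewrite /c in c2; lia.
  by rewrite expr0 mul1r.
apply: le_trans (step _ _ ij') _.
apply: le_trans (_ : lam ^+ (i - (w == x) + (j - (w == y)) - 2) * lam ^+ c <= _).
  by rewrite ler_wpM2l ?exprn_ge0.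
rewrite -exprD; apply: le_trans (_ : lam ^+ (i + j - 2) <= _).
  by apply: ler_wiXn2l => //; rewrite /c; lia.
by rewrite ler_peMr // exprn_ge0.
Qed.

(* [binw p q i k] is 'C(i, k) p^(i - k) q^k; only Pascal's rule is needed. *)
Fixpoint binw (p q : R) i k : R :=
  match i, k with
  | 0, 0 => 1
  | 0, _.+1 => 0
  | i'.+1, 0 => p * binw p q i' 0
  | i'.+1, k'.+1 => p * binw p q i' k'.+1 + q * binw p q i' k'
  end.

Section Binw.
Context (p q : R) (p0 : 0 <= p) (q0 : 0 <= q) (pq1 : p + q <= 1).

Lemma binw_ge0 i k : 0 <= binw p q i k.
Proof.
by elim: i k => [|i IH] [|k] //=; rewrite ?addr_ge0 // mulr_ge0.
Qed.

Lemma binw_le1 i k : binw p q i k <= 1.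
Proof.
elim: i k => [|i IH] [|k] //=.
  by have := ler_piMr p0 (IH 0%N); move: p0 q0 pq1; lra.
by have := ler_piMr p0 (IH k.+1); have := ler_piMr q0 (IH k); move: pq1; lra.
Qed.

Lemma binw_small i k : (i < k)%N -> binw p q i k = 0.
Proof.
elim: i k => [|i IH] [|k] //= ik.
by rewrite !IH ?mulr0 ?addr0 // ltnW.
Qed.

Lemma binw_sum i : \sum_(0 <= k < i.+1) binw p q i k = (p + q) ^+ i.
Proof.
elim: i => [|i IH]; first by rewrite big_nat1.
rewrite big_nat_recl //= big_split /= -!mulr_sumr addrA IH exprS mulrDl.
congr (_ + _); rewrite -IH [in RHS]big_nat_recl // mulrDr; congr (_ + _ * _).
by rewrite big_nat_recr //= binw_small // addr0.
Qed.

(* Total weight of the words with [i] letters x and [j] letters y that start with x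
   (for [trace_wx]) or y (for [trace_wy]) and end with y, a repetition being worth [p]
   and a change [q]; the summand is the weight of those with [k + 1] blocks of each
   letter, resp. one more block of y.  The cut-off [M] only keeps the sum finite. *)
Definition trace_wx M i j : R :=
  match i, j with
  | i'.+1, j'.+1 => q * \sum_(0 <= k < M) binw p q i' k * binw p q j' k
  | _, _ => 0
  end.

Definition trace_wy M i j : R :=
  match i, j with
  | i'.+1, j'.+1 => q * \sum_(0 <= k < M) binw p q i' k * binw p q j' k.+1
  | 0, j'.+1 => p ^+ j'
  | _, _ => 0
  end.

Lemma trace_wx_ge0 M i j : 0 <= trace_wx M i j.
Proof.
case: i j => [|i] [|j] //=; rewrite mulr_ge0 // sumr_ge0 // => k _.
by rewrite mulr_ge0 ?binw_ge0.
Qed.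

Lemma trace_wy_ge0 M i j : 0 <= trace_wy M i j.
Proof.
case: i j => [|i] [|j] //=; first by rewrite exprn_ge0.
by rewrite mulr_ge0 // sumr_ge0 // => k _; rewrite mulr_ge0 ?binw_ge0.
Qed.

Lemma trace_w_le M i j : trace_wx M i j <= M.+1%:R /\ trace_wy M i j <= M.+1%:R.
Proof.
have q1 : q <= 1 by move: p0 pq1; lra.
have bnd (F : nat -> R) : (forall k, 0 <= F k <= 1) -> q * \sum_(0 <= k < M) F k <= M.+1%:R.
  move=> hF; have h : \sum_(0 <= k < M) F k <= M%:R.
    apply: le_trans (_ : \sum_(0 <= k < M) 1 <= _).
      by apply: ler_sum => k _; case/andP: (hF k).
    by rewrite sumr_const_nat subn0.
  have h0 : 0 <= \sum_(0 <= k < M) F k by apply: sumr_ge0 => k _; case/andP: (hF k).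
  by have := ler_wpM2r h0 q1; rewrite mul1r -natr1; lra.
have b01 a b c d : 0 <= binw p q a b * binw p q c d <= 1.
  by rewrite mulr_ge0 ?binw_ge0 //= mulr_ile1 ?binw_ge0 ?binw_le1.
case: i j => [|i] [|j] //=; split=> //; try exact: bnd.
rewrite -natr1; apply: le_trans (_ : 1 <= _); last by rewrite lerDr.
by apply: exprn_ile1 => //; move: q0 pq1; lra.
Qed.

(** Removing the first letter x leaves a word that starts with x or with y; for the block weights
    this is Pascal's rule. Equality can fail because of the cut-off. *)
Lemma trace_wx_rec M i j :
  trace_wx M i.+1 j <= p * trace_wx M i j + q * trace_wy M i j.
Proof.
case: j => [|j]; first by rewrite /= addr_ge0 // mulr_ge0 ?trace_wx_ge0 ?trace_wy_ge0.
case: i => [|i].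
  rewrite /= mulr0 add0r ler_wpM2l //.
  case: M => [|M]; first by rewrite big_geq // exprn_ge0.
  rewrite big_nat_recl // big1 => [|k _]; last by rewrite /= mul0r.
  rewrite /= mul1r addr0.
  by elim: j => //= j IH; rewrite exprS ler_wpM2l.
rewrite [p * _]mulrCA [q * trace_wy _ _ _]mulrCA -mulrDr ler_wpM2l //.
case: M => [|M]; first by rewrite !big_geq // !mulr0 addr0.
rewrite !big_nat_recl // [in X in _ <= X]mulrDr !mulr_sumr /=.
rewrite -!addrA mulrA lerD2l.
apply: le_trans (_ : \sum_(0 <= k < M) p * (binw p q i k.+1 * binw p q j k.+1) +
   \sum_(0 <= k < M) q * (binw p q i k * binw p q j k.+1) <= _).
  rewrite -big_split /=; apply: ler_sum => k _.
  by rewrite mulrDl !mulrA.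
rewrite lerD2l -mulr_sumr ler_wpM2l //.
rewrite -[leRHS](@big_nat_recl R 0 +%R M 0 (fun k => binw p q i k * binw p q j k.+1)) //.
by rewrite big_nat_recr //= lerDl mulr_ge0 ?binw_ge0.
Qed.

(** The condition excludes the one-letter word y, which has weight 1 and no successor. *)
Lemma trace_wy_rec M i j : (0 < i + j)%N ->
  trace_wy M i j.+1 <= p * trace_wy M i j + q * trace_wx M i j.
Proof.
case: i j => [|i] [|j] // _.
- by rewrite /= mulr0 addr0 exprS.
- rewrite /= !mulr0 addr0 big1 ?mulr0 // => k _.
  by rewrite mulr0.
rewrite /= [p * _]mulrCA [q * (q * _)]mulrCA -mulrDr ler_wpM2l //.
rewrite 2!mulr_sumr -big_split /=; apply: ler_sum => k _.
by rewrite mulrDr mulrCA [_ * (q * _)]mulrCA.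
Qed.

Lemma sqr_sum_le m (a : nat -> R) :
  (\sum_(0 <= k < m) a k) ^+ 2 <= m%:R * \sum_(0 <= k < m) a k ^+ 2.
Proof.
elim: m => [|m IH]; first by rewrite !big_geq // expr0n mul0r.
rewrite !big_nat_recr //=.
have Q0 : 0 <= \sum_(0 <= k < m) a k ^+ 2 by apply: sumr_ge0 => k _; exact: sqr_ge0.
move: (a m) IH Q0; move: (\sum_(0 <= k < m) a k) (\sum_(0 <= k < m) a k ^+ 2) => S Q x IH Q0.
case: m IH => [|m] IH.
  have := sqr_ge0 S; rewrite mul0r in IH => S2.
  have /eqP : S ^+ 2 = 0 by apply/eqP; rewrite eq_le IH S2.
  by rewrite sqrf_eq0 => /eqP ->; rewrite add0r mul1r lerDr.
rewrite -[m.+2%:R]natr1; have m0 : 0 < m.+1%:R :> R by rewrite ltr0n.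
move: (m.+1%:R) m0 IH => n n0 IH.
have h : 0 <= Q + n * x ^+ 2 - 2 * S * x.
  rewrite -(pmulr_rge0 _ n0).
  have := sqr_ge0 (S - n * x); move: IH; clear; lra.
by move: h IH; clear; lra.
Qed.

Lemma trace_wx_diag t :
  q * (p + q) ^+ (2 * t) / t.+1%:R <= trace_wx t.+1 t.+1 t.+1.
Proof.
rewrite /= -mulrA ler_wpM2l // ler_pdivrMr ?ltr0n // mulrC [(2 * t)%N]mulnC exprM.
rewrite -binw_sum; apply: le_trans (sqr_sum_le _ _) _.
by rewrite ler_wpM2l // ler_sum.
Qed.

End Binw.

Lemma nsq_inb n w : inb n w = (sqnorm w <= n%:R ^+ 2 :> R).
Proof.
have -> : (n%:R : R) ^+ 2 = (n%:Z ^+ 2)%:~R by rewrite rmorphXn.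
by rewrite /sqnorm ler_int.
Qed.

(** The walk raises |z|^2 by exactly 1 per step on average. The radius n + 2 keeps the function at
    least 1 on D(0, n + 1), the range reached by one step out of the disc. *)
Definition exit_psi n w : R := n.+2%:R ^+ 2 - sqnorm w.

Lemma exit_psi_avg n w : avg4 (exit_psi n) w = exit_psi n w - 1.
Proof.
rewrite avg4E /exit_psi /sqnorm /= !rmorphD /= !rmorphXn /= !rmorphD /= !rmorphN /=.
by lra.
Qed.

Lemma exit_psi_ge1 n w : inb n.+1 w -> 1 <= exit_psi n w.
Proof.
rewrite nsq_inb /exit_psi -[n.+2%:R]natr1.
have n0 : 0 <= n.+1%:R :> R by [].
by move: n.+1%:R (sqnorm w) n0 => c d; lra.
Qed.

Lemma box_inb n z : inb n z -> z \in box n.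
Proof.
case: z => a b; rewrite /inb /= => h.
have n0 : 0 <= n%:Z by [].
have [ha hb] : (- n%:Z <= a <= n%:Z) /\ (- n%:Z <= b <= n%:Z).
  by move: n0 h; move: (n%:Z) => c n0 h; split; apply/andP; split; nra.
apply/allpairsP; exists (absz (a + n%:Z), absz (b + n%:Z)); rewrite !mem_iota /=.
by split; [lia|lia|congr (_, _); lia].
Qed.

(** [hx] and [hy] minorise the probabilities that x, resp. y, is the first of the two sites visited
    before exit. Weighted with the word sums they form a subsolution of the recursion for [pu]; the
    subtracted term, geometric in N, pays for paths that have not left after N steps. *)
Lemma pu_lower n x y (hx hy : Z2 -> R) p q M :
  0 <= p -> 0 <= q -> p + q <= 1 -> x != y -> inb n x -> inb n y ->
  hx x = 1 -> hx y = 0 -> hy x = 0 -> hy y = 1 ->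
  (forall z, inb n z -> z != x -> z != y -> avg4 hx z = hx z /\ avg4 hy z = hy z) ->
  avg4 hx x = p -> avg4 hx y = q -> avg4 hy x = q -> avg4 hy y = p ->
  (forall z, ~~ inb n z -> inb n.+1 z -> hx z <= 0 /\ hy z <= 0) ->
  exists C, forall N i j w, inb n.+1 w ->
    (if (i == 0%N) && (j == 0%N) then 1 else
       hx w * trace_wx p q M i j + hy w * trace_wy p q M i j) -
    C * (1 - (n.+2%:R ^+ 2)^-1) ^+ N * exit_psi n w <= pu n x y N i j w.
Proof.
move=> p0 q0 pq1 xy inx iny hxx hxy hyx hyy harm hxp hxq hyq hyp hout.
pose B : R := \sum_(z <- box n) (`|hx z| + `|hy z|).
have B0 : 0 <= B by apply: sumr_ge0 => z _; exact: addr_ge0.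
have hB z : inb n z -> `|hx z| + `|hy z| <= B.
  move=> /box_inb hz; rewrite /B (big_rem z) //= lerDl.
  by apply: sumr_ge0 => ? _; exact: addr_ge0.
(* Large enough for N = 0, where the left-hand side must be at most 0: [B] bounds the two functions
   on the disc and M + 1 the word sums. *)
pose C : R := 1 + B * M.+1%:R; exists C.
have C0 : 0 <= C by rewrite /C addr_ge0 // mulr_ge0.
set L : R := n.+2%:R ^+ 2.
have L1 : 1 <= L by rewrite /L exprn_ege1 // ler1n.
have L0 : 0 < L by lra.
have rho0 : 0 <= 1 - L^-1 by rewrite subr_ge0 invf_le1.
have Wx := trace_wx_ge0 p0 q0 M; have Wy := trace_wy_ge0 p0 q0 M.
set v := fun i j w => if (i == 0%N) && (j == 0%N) then 1 else
  hx w * trace_wx p q M i j + hy w * trace_wy p q M i j.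
have avgv i j w : (0 < i + j)%N -> avg4 (v i j) w =
    avg4 hx w * trace_wx p q M i j + avg4 hy w * trace_wy p q M i j.
  by rewrite !avg4E /v; case: i j => [|i] [|j] //= _; lra.
have avg0 i j w : (i + j = 0)%N -> avg4 (v i j) w = 1.
  by rewrite !avg4E /v; case: i j => [|i] [|j] //= _; lra.
have vout i j w : ~~ inb n w -> inb n.+1 w -> v i j w <= ((i == 0%N) && (j == 0%N))%:R.
  move=> h1 h2; rewrite /v; case: ifP => // _; have [hx0 hy0] := hout w h1 h2.
  have := Wx i j; have := Wy i j.
  by move=> h3 h4; rewrite mulr0n; have := mulr_le0_ge0 hx0 h4; have := mulr_le0_ge0 hy0 h3; lra.
have rho_psi N w : inb n.+1 w -> 0 <= C * (1 - L^-1) ^+ N * exit_psi n w.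
  move=> hw; rewrite mulr_ge0 ?mulr_ge0 ?exprn_ge0 //.
  by apply: le_trans (exit_psi_ge1 hw).
have pu_out N i j w : ~~ inb n w -> pu n x y N i j w = ((i == 0%N) && (j == 0%N))%:R :> R.
  by case: N => [|N] /= /negbTE ->.
elim=> [|N IH] i j w hw; rewrite -/(v i j w); have [hin|hout'] := boolP (inb n w);
    try by rewrite pu_out // lerBlDr;
      apply: le_trans (vout i j w hout' hw) _; rewrite lerDl rho_psi.
  apply: le_trans (_ : 0 <= _); last exact: pu_ge0.
  rewrite expr0 mulr1 subr_le0; apply: le_trans (_ : C <= _); last first.
    by rewrite ler_peMr // exit_psi_ge1.
  rewrite /v /C; case: ifP => _; first by rewrite lerDl mulr_ge0.
  have [h1 h2] := trace_w_le p0 q0 pq1 M i j.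
  apply: le_trans (_ : (`|hx w| + `|hy w|) * M.+1%:R <= _).
    rewrite mulrDl lerD //.
      apply: le_trans (_ : `|hx w| * trace_wx p q M i j <= _); last exact: ler_wpM2l.
      by rewrite ler_wpM2r // ler_norm.
    apply: le_trans (_ : `|hy w| * trace_wy p q M i j <= _); last exact: ler_wpM2l.
    by rewrite ler_wpM2r // ler_norm.
  apply: le_trans (_ : B * M.+1%:R <= _); last by rewrite lerDr.
  by rewrite ler_wpM2r // hB.
rewrite /= hin.
have [i' Ei] : exists i', (i - (w == x))%N = i' by eexists.
have [j' Ej] : exists j', (j - (w == y))%N = j' by eexists.
rewrite Ei Ej.
apply: le_trans (_ : avg4 (fun z => v i' j' z - C * (1 - L^-1) ^+ N * exit_psi n z) w <= _);
  last by apply: avg4_le => k; apply: IH; exact: inb_step.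
have -> : avg4 (fun z => v i' j' z - C * (1 - L^-1) ^+ N * exit_psi n z) w =
   avg4 (v i' j') w - C * (1 - L^-1) ^+ N * (exit_psi n w - 1).
  by rewrite -exit_psi_avg !avg4E; lra.
(* [exit_psi] is at most L, so losing 1 is at least as good as multiplying by 1 - 1/L. *)
apply: lerB; last first.
  rewrite exprSr -!mulrA ler_wpM2l // ler_wpM2l ?exprn_ge0 //.
  rewrite mulrBl mul1r lerD2l lerN2 mulrC ler_pdivrMr // mul1r.
  by rewrite /exit_psi gerBl nsq_ge0.
have [wx|wx] := eqVneq w x.
  move: Ei Ej; rewrite wx eqxx (negbTE xy) subn0 => Ei Ej; rewrite -Ej.
  (* With no visit to x left to make, a word cannot start with x: the subsolution is 0 here unless j
     = 0 as well, when both sides are 1. *)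
  case: i Ei => [|i] Ei.
    rewrite -Ei sub0n; case: (j) => [|k]; first by rewrite avg0.
    by rewrite avgv // hxp hyq /v /= hxx hyx !mulr0 !mul0r addr0 add0r mulr_ge0 // exprn_ge0.
  move: Ei; rewrite subn1 /= => <-; rewrite /v /= hxx hyx mul1r mul0r addr0.
  have [h|h] := posnP (i + j).
    by rewrite avg0 //; case: (j) h => [|k] //; rewrite addnS.
  by rewrite avgv // hxp hyq; exact: trace_wx_rec.
have [wy|wy] := eqVneq w y.
  move: Ei Ej; rewrite wy eqxx eq_sym (negbTE xy) subn0 => Ei Ej; rewrite -Ei.
  case: j Ej => [|j] Ej.
    rewrite -Ej sub0n; case: (i) => [|k]; first by rewrite avg0.
    by rewrite avgv // hxq hyp /v /= hxy hyy !mulr0 addr0.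
  move: Ej; rewrite subn1 /= => <-; rewrite /v andbF hxy hyy mul1r mul0r add0r.
  have [h|h] := posnP (i + j).
    by rewrite avg0 //; case: (i) (j) h => [|k] [|l] //= _; rewrite expr0.
  by rewrite avgv // hxq hyp addrC; exact: trace_wy_rec.
have [hhx hhy] := harm w hin wx wy.
rewrite -Ei -Ej (negbTE wx) (negbTE wy) !subn0.
have [h|h] := posnP (i + j).
  by rewrite avg0 //; case: (i) (j) h => [|k] [|l].
by rewrite avgv // hhx hhy /v; case: (i) (j) h => [|k] [|l].
Qed.

Lemma plim_upper n x y H lam T : 0 <= lam <= 1 ->
  (forall z, inb n.+1 z -> 0 <= H z) ->
  (forall z, inb n z -> z != x -> z != y -> avg4 H z <= H z) ->
  (forall z, inb n z -> (z == x) || (z == y) ->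
     1 <= H z /\ avg4 H z <= lam ^+ ((z == x) + (z == y))) ->
  (0 < T)%N -> plim n x y T <= lam ^+ (2 * T - 2) * H (0, 0).
Proof.
move=> l01 H0 Hh Hxy T0; apply: limr_le; first by apply: cvgP; exact: cvg_pu.
apply: nearW => N; rewrite mul2n -addnn; apply: pu_upper => //.
  by rewrite addn_gt0 T0.
Qed.

Lemma plim_lower n x y (hx hy : Z2 -> R) p q t :
  0 <= p -> 0 <= q -> p + q <= 1 -> x != y -> inb n x -> inb n y ->
  hx x = 1 -> hx y = 0 -> hy x = 0 -> hy y = 1 ->
  (forall z, inb n z -> z != x -> z != y -> avg4 hx z = hx z /\ avg4 hy z = hy z) ->
  avg4 hx x = p -> avg4 hx y = q -> avg4 hy x = q -> avg4 hy y = p ->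
  (forall z, ~~ inb n z -> inb n.+1 z -> hx z <= 0 /\ hy z <= 0) ->
  0 <= hx (0, 0) -> 0 <= hy (0, 0) ->
  hx (0, 0) * (q * (p + q) ^+ (2 * t) / t.+1%:R) <= plim n x y t.+1.
Proof.
move=> p0 q0 pq1 xy inx iny e1 e2 e3 e4 harm e5 e6 e7 e8 hout hx0 hy0.
have [C hC] := pu_lower t.+1 p0 q0 pq1 xy inx iny e1 e2 e3 e4 harm e5 e6 e7 e8 hout.
have in0 : inb n.+1 (0, 0) by rewrite /inb /= expr0n addr0 sqr_ge0.
set rho := 1 - _ in hC.
have L1 : 1 < n.+2%:R ^+ 2 :> R by rewrite exprn_egt1 // ltr1n.
have rho1 : `|rho| < 1.
  rewrite /rho; move: (n.+2%:R ^+ 2) L1 => L L1.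
  have h0 : 0 < L^-1 by rewrite invr_gt0; lra.
  have h1 : L^-1 < 1 by rewrite invf_lt1; lra.
  by rewrite ger0_norm; lra.
set a := hx (0, 0) * _.
have lim : (fun N => a - C * rho ^+ N * exit_psi n (0, 0)) @ \oo --> a - C * 0 * exit_psi n (0, 0).
  apply: cvgB; first exact: cvg_cst.
  by apply: cvgMl; apply: cvgMr; exact: cvg_expr.
rewrite mulr0 mul0r subr0 in lim.
apply: (cvgr_to_le lim); apply: nearW => N.
apply: le_trans (nondecreasing_cvgn_le (pu_ndecr n x y t.+1 t.+1 (0, 0)) _ N);
  last by apply: cvgP; exact: cvg_pu.
apply: le_trans (hC N t.+1 t.+1 (0, 0) in0).
rewrite lerD2r /= /a -[leLHS]addr0 lerD //; last first.
  by rewrite mulr_ge0 // (trace_wy_ge0 p0 q0 t.+1 t.+1 t.+1).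
by rewrite ler_wpM2l //; exact: trace_wx_diag.
Qed.

End Comparison.

(** * Harmonic functions built from the kernel *)

Section Hitting.
Context {R : realType}.
Implicit Types (w x y z : Z2) (n N i j m : nat).
Local Notation pot := (@pot R).
Local Notation nsq := (@sqnorm R).

Definition subp z x : Z2 := (z.1 - x.1, z.2 - x.2).

Lemma pot_subC x y : pot (subp x y) = pot (subp y x).
Proof. by rewrite -potN /subp /= !opprB. Qed.

Lemma pot_sub_diag x : pot (subp x x) = 0.
Proof. by rewrite /subp !subrr pot0. Qed.

Lemma avg4_pot_sub x z :
  avg4 (fun v => pot (subp v x)) z = pot (subp z x) + (z == x)%:R.
Proof.
have -> : avg4 (fun v => pot (subp v x)) z = avg4 pot (subp z x).
  rewrite !avg4E /subp /=.
  by rewrite ![_ + 1 - _]addrAC ![_ - 1 - _]addrAC.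
rewrite pot_avg4; congr (_ + _%:R); congr nat_of_bool.
by case: z x => [a b] [a' b']; rewrite /subp !xpair_eqE /= !subr_eq0.
Qed.

Lemma nsq_sub z x : nsq (subp z x) <= 2 * (nsq z + nsq x).
Proof.
rewrite /sqnorm /subp /= !rmorphD /= !rmorphXn /= !rmorphD /= !rmorphN /=.
have := sqr_ge0 (z.1%:~R + x.1%:~R : R); have := sqr_ge0 (z.2%:~R + x.2%:~R : R).
lra.
Qed.

(** An explicit upper bound playing the role of M: two points of D(0, n + 1) differ by at most 2(n +
    1), and 5 is the error in [pot_bound]. *)
Definition pot_max n : R := ln (1 + 4 * n.+1%:R ^+ 2) / pi + 5.

Lemma pot_max_ge5 n : 5 <= pot_max n.
Proof.
rewrite /pot_max lerDr divr_ge0 ?pi_ge0 // ln_ge0 // lerDl.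
by rewrite mulr_ge0 // sqr_ge0.
Qed.

Lemma pot_le_max n x z : inb n.+1 x -> inb n.+1 z -> pot (subp z x) <= pot_max n.
Proof.
rewrite !(@nsq_inb R) => hx hz; have := pot_bound (R := R) (subp z x).
rewrite ler_norml => /andP[_]; rewrite lerBlDr addrC => /le_trans; apply.
rewrite lerD2r ler_pM2r ?invr_gt0 ?pi_gt0 //.
have h := nsq_sub z x; have h0 := @nsq_ge0 R (subp z x).
have := sqr_ge0 (n.+1%:R : R); move: (n.+1%:R ^+ 2) hx hz => k hx hz k0.
by rewrite ler_ln ?posrE; lra.
Qed.

Lemma plim_le n x y T : (0 < T)%N -> inb n x -> inb n y ->
  plim n x y T <=
    2 * expR (1 - 2 * T%:R / (2 * pot_max n - pot (subp x y))).
Proof.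
move=> T0 hx hy; set a := pot (subp x y); set D := _ - a.
have M5 := pot_max_ge5 n.
have a0 : 0 <= a by exact: pot_ge0.
have aM : a <= pot_max n by apply: pot_le_max; exact: inbW.
have D5 : 5 <= D by rewrite /D; lra.
pose H z := 1 - (pot (subp z x) + pot (subp z y) - a) / D.
have avgH z : avg4 H z = H z - ((z == x)%:R + (z == y)%:R) / D.
  have := avg4_pot_sub x z; have := avg4_pot_sub y z.
  rewrite !avg4E /H => h1 h2.
  have -> : pot (subp z x) = (pot (subp (z.1 + 1, z.2) x) + pot (subp (z.1 - 1, z.2) x) +
       pot (subp (z.1, z.2 + 1) x) + pot (subp (z.1, z.2 - 1) x)) / 4 - (z == x)%:R by lra.
  have -> : pot (subp z y) = (pot (subp (z.1 + 1, z.2) y) + pot (subp (z.1 - 1, z.2) y) +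
       pot (subp (z.1, z.2 + 1) y) + pot (subp (z.1, z.2 - 1) y)) / 4 - (z == y)%:R by lra.
  by clear - D5; field; lra.
have iD : 0 < D^-1 by rewrite invr_gt0; lra.
have iD1 : D^-1 <= 5^-1 by rewrite lef_pV2 ?posrE; lra.
have lam01 : 0 <= 1 - D^-1 <= 1 by apply/andP; split; lra.
apply: le_trans (@plim_upper R n x y H (1 - D^-1) T lam01 _ _ _ T0) _.
- move=> z hz; rewrite /H subr_ge0 ler_pdivrMr ?mul1r; last by lra.
  have := pot_le_max (inbW hx) hz; have := pot_le_max (inbW hy) hz.
  by rewrite /D; lra.
- by move=> z hz /negbTE zx /negbTE zy; rewrite avgH zx zy addr0 mul0r subr0.
- move=> z hz zxy.
  have Hz : H z = 1.
    rewrite /H; case/orP: zxy => /eqP ->.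
      by rewrite pot_sub_diag add0r subrr mul0r subr0.
    by rewrite pot_sub_diag addr0 pot_subC subrr mul0r subr0.
  split; first by rewrite Hz.
  rewrite avgH Hz; case: (z == x) zxy; case: (z == y) => //= _.
  (* The case x = y: one visit loses 2/D, and 1 - 2/D <= (1 - 1/D)^2. *)
  + have := sqr_ge0 D^-1; move: (D^-1) => c c2.
    by have -> : (1 : R) + 1 = 2 by []; lra.
  + by rewrite addr0 mul1r expr1.
  + by rewrite add0r mul1r expr1.
have H0 : H (0, 0) <= 2.
  have := pot_ge0 (R := R) (subp (0, 0) x); have := pot_ge0 (R := R) (subp (0, 0) y).
  rewrite /H => h1 h2; rewrite lerBlDr -lerBlDl.
  rewrite ler_pdivlMr; last by lra.
  by rewrite /D; lra.
rewrite mulrC; apply: ler_pM => //.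
- rewrite /H subr_ge0 ler_pdivrMr ?mul1r; last by lra.
  have in0 : inb n.+1 (0, 0) by rewrite /inb /= expr0n addr0 sqr_ge0.
  have := pot_le_max (inbW hx) in0; have := pot_le_max (inbW hy) in0.
  by rewrite /D; lra.
- by rewrite exprn_ge0 //; lra.
(* Replacing the exponent 2T - 2 by 2T costs exp(2/D), absorbed by the 1 in the exponential because
   D >= 5. *)
apply: le_trans (_ : expR (- D^-1) ^+ (2 * T - 2) <= _).
  by rewrite lerXn2r ?nnegrE ?expR_ge0 //; [lra|exact: expR_ge1Dx].
rewrite -expRM_natl ler_expR.
have e2 : (2 * T - 2)%:R = 2 * T%:R - 2 :> R.
  by clear - T0; rewrite natrB ?natrM //; case: T T0 => // k _; rewrite mulnS.
rewrite e2.
by move: (D^-1) (T%:R) iD iD1 => c t; lra.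
Qed.

(** [m] is a free parameter. The boundary hypothesis asks it to be small enough for both functions
    to be at most 0 outside the disc; [kap] bounds both from below at the origin. *)
Lemma plim_ge n x y t (m kap : R) :
  x != y -> inb n x -> inb n y ->
  let a := pot (subp x y) in
  1 <= a -> a <= m ->
  (forall z, ~~ inb n z -> inb n.+1 z ->
     `|pot (subp z y) - pot (subp z x)| / a <=
     (pot (subp z x) + pot (subp z y) - a) / m - 1) ->
  0 <= kap ->
  kap <= (1 - (pot (subp (0, 0) x) + pot (subp (0, 0) y) - a) / m
           - `|pot (subp (0, 0) y) - pot (subp (0, 0) x)| / a) / 2 ->
  kap * ((a^-1 - m^-1) / 2 * (1 - m^-1) ^+ (2 * t) / t.+1%:R) <= plim n x y t.+1.
Proof.
move=> xy hx hy a a1 am hout kap0 hkap.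
have a0 : 0 < a by lra.
have m0 : 0 < m by lra.
pose p := 1 - (m^-1 + a^-1) / 2; pose q := (a^-1 - m^-1) / 2.
have im : 0 < m^-1 by rewrite invr_gt0.
have ia : 0 < a^-1 by rewrite invr_gt0.
have ima : m^-1 <= a^-1 by rewrite lef_pV2.
have ia1 : a^-1 <= 1 by rewrite invf_le1.
have p0 : 0 <= p by rewrite /p; lra.
have q0 : 0 <= q by rewrite /q; lra.
have epq : p + q = 1 - m^-1 by rewrite /p /q; lra.
(* The symmetric half is 1/2 at both sites, the antisymmetric half 1/2 at one and -1/2 at the other.
   The sign e = 1 gives the function for x, e = -1 the one for y. *)
pose h (e : R) z := (1 - (pot (subp z x) + pot (subp z y) - a) / m) / 2 +
   e * ((pot (subp z y) - pot (subp z x)) / a) / 2.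
have avgh e z : avg4 (h e) z = h e z - ((z == x)%:R + (z == y)%:R) / m / 2 +
    e * (((z == y)%:R - (z == x)%:R) / a) / 2.
  have := avg4_pot_sub x z; have := avg4_pot_sub y z.
  rewrite !avg4E /h => h1 h2.
  have -> : pot (subp z x) = (pot (subp (z.1 + 1, z.2) x) + pot (subp (z.1 - 1, z.2) x) +
       pot (subp (z.1, z.2 + 1) x) + pot (subp (z.1, z.2 - 1) x)) / 4 - (z == x)%:R by lra.
  have -> : pot (subp z y) = (pot (subp (z.1 + 1, z.2) y) + pot (subp (z.1 - 1, z.2) y) +
       pot (subp (z.1, z.2 + 1) y) + pot (subp (z.1, z.2 - 1) y)) / 4 - (z == y)%:R by lra.
  by clear - a0 m0; field; lra.
have hx1 e : h e x = (1 + e) / 2.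
  by rewrite /h pot_sub_diag -/a add0r subrr mul0r !subr0 divff ?gt_eqF //; lra.
have hy1 e : h e y = (1 - e) / 2.
  rewrite /h pot_sub_diag pot_subC -/a addr0 subrr mul0r subr0 sub0r mulNr divff ?gt_eqF //.
  by lra.
have yx : (y == x) = false by rewrite eq_sym (negbTE xy).
have ahx e : avg4 (h e) x = (1 + e) / 2 - m^-1 / 2 - e * a^-1 / 2.
  rewrite avgh hx1 eqxx (negbTE xy) addr0 sub0r mulNr !mul1r; lra.
have ahy e : avg4 (h e) y = (1 - e) / 2 - m^-1 / 2 + e * a^-1 / 2.
  rewrite avgh hy1 eqxx yx add0r subr0 !mul1r; lra.
have nrm z (e : R) : `|e| = 1 -> e * ((pot (subp z y) - pot (subp z x)) / a) <=
    `|pot (subp z y) - pot (subp z x)| / a.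
  move=> e1; rewrite mulrA ler_pM2r //; apply: le_trans (ler_norm _) _.
  by rewrite normrM e1 mul1r.
have nrmN z (e : R) : `|e| = 1 -> - (`|pot (subp z y) - pot (subp z x)| / a) <=
    e * ((pot (subp z y) - pot (subp z x)) / a).
  move=> e1; rewrite lerNl -mulNr; apply: nrm; by rewrite normrN.
have n1 : `|1 : R| = 1 by rewrite normr1.
have n2 : `|-1 : R| = 1 by rewrite normrN normr1.
have ho (e : R) : `|e| = 1 -> kap <= h e (0, 0).
  move=> e1; have := nrmN (0, 0) e e1; move: hkap; rewrite /h.
  by move: (_ / m) (`|_| / a) (e * _) => A B C; lra.
have hz (e : R) : `|e| = 1 -> forall z, ~~ inb n z -> inb n.+1 z -> h e z <= 0.
  move=> e1 z z1 z2; have := nrm z e e1; have := hout z z1 z2; rewrite /h.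
  by move: (_ / m) (`|_| / a) (e * _) => A B C; lra.
have := @plim_lower R n x y (h 1) (h (-1)) p q t p0 q0.
rewrite epq => /(_ _ xy hx hy) key.
apply: le_trans (key _ _ _ _ _ _ _ _ _ _ _ _ _).
- rewrite ler_wpM2r ?ho // mulr_ge0 ?invr_ge0 // mulr_ge0 // exprn_ge0 //.
  by move: ima ia1; clear; lra.
- by move: im; clear; lra.
- by rewrite hx1; clear; lra.
- by rewrite hy1; clear; lra.
- by rewrite hx1; clear; lra.
- by rewrite hy1; clear; lra.
- by move=> z _ /negbTE zx /negbTE zy; rewrite !avgh zx zy !(addr0, subr0, mul0r, mulr0).
- by rewrite ahx /p; clear; lra.
- by rewrite ahy /q; clear; lra.
- by rewrite ahx /q; clear; lra.
- by rewrite ahy /p; clear; lra.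
- by move=> z z1 z2; split; apply: hz.
- by apply: le_trans kap0 _; exact: ho.
- by apply: le_trans kap0 _; exact: ho.
Qed.

End Hitting.

(** * Upper bound *)

Section Upper.
Context {R : realType}.
Implicit Types (w x y z : Z2) (n N i j m : nat).
Local Notation pot := (@pot R).
Local Notation nsq := (@sqnorm R).

(** With z = 2 - g the left-hand side is 2g - 4 alpha/(2 - g). The gap to the maximum is explicit: a
    product of two nonnegative factors when beta is the maximiser, a square over z when z = sqrt(2
    alpha) is admissible. *)
Lemma rho2_ge (alpha beta z : R) : 0 < alpha -> 0 < beta < 1 -> 2 - beta <= z ->
  4 - 2 * z - 4 * alpha / z <= rho2 alpha beta - 2.
Proof.
move=> a0 /andP[b0 b1] zb.
have z0 : 0 < z by lra.
rewrite /rho2; case: ifPn => [hb|_].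
  have s0 := sqrtr_ge0 (2 * alpha).
  have s2 : Num.sqrt (2 * alpha) ^+ 2 = 2 * alpha by rewrite sqr_sqrtr; lra.
  have h1 : 2 * alpha <= (2 - beta) * z.
    rewrite -s2 expr2; apply: ler_pM => //; lra.
  have b2 : 0 < 2 - beta by lra.
  rewrite -subr_ge0.
  have -> : 2 + 2 * beta - 4 * alpha / (2 - beta) - 2 - (4 - 2 * z - 4 * alpha / z) =
    2 * (z - (2 - beta)) * ((2 - beta) * z - 2 * alpha) / ((2 - beta) * z).
    by clear - z0 b2; field; lra.
  apply: divr_ge0; last by apply: mulr_ge0; lra.
  by apply: mulr_ge0; lra.
have s2 : Num.sqrt (2 * alpha) ^+ 2 = 2 * alpha by rewrite sqr_sqrtr; lra.
have -> : 4 * alpha = 2 * Num.sqrt (2 * alpha) ^+ 2 by rewrite s2; lra.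
move: (Num.sqrt _) => s; rewrite -subr_ge0.
have -> : 6 - 4 * s - 2 - (4 - 2 * z - 2 * s ^+ 2 / z) = 2 * (z - s) ^+ 2 / z.
  by clear - z0; field; lra.
apply: divr_ge0; last exact: ltW.
by apply: mulr_ge0; rewrite ?sqr_ge0.
Qed.

Lemma ln_le_id (x : R) : 0 < x -> ln x <= x.
Proof. by move=> x0; rewrite ltW // ln_sublinear. Qed.

Lemma pot_max_le n : (0 < n)%N -> pot_max n <= 2 * ln n%:R / pi + 14 :> R.
Proof.
move=> n0; have n1 : 1 <= n%:R :> R by rewrite ler1n.
have pi2 := pi_ge2 R.
have ip : pi^-1 <= 2^-1 :> R by rewrite lef_pV2 ?posrE //; lra.
have ip0 : 0 < pi^-1 :> R by rewrite invr_gt0; lra.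
have h : ln (1 + 4 * n.+1%:R ^+ 2) <= 17 + 2 * ln n%:R :> R.
  apply: le_trans (_ : ln (17 * n%:R ^+ 2) <= _).
    by rewrite -natr1 ler_ln ?posrE; nra.
  rewrite lnM ?posrE ?exprn_gt0 //; last by lra.
  rewrite lnXn; last by lra.
  by rewrite -[ln n%:R *+ 2]mulr_natl lerD2r; apply: ln_le_id.
rewrite /pot_max; move: h ip ip0; move: (ln _) (ln _) (pi^-1) => A B p h h1 h2.
have := ler_wpM2r (ltW h2) h; lra.
Qed.

Lemma d_nsq x y (r : R) : 0 <= r -> (d x y <= r) = (nsq (subp x y) <= r ^+ 2).
Proof.
move=> r0; rewrite /d -[in LHS](ger0_norm r0) -sqrtr_sqr ler_sqrt ?sqr_ge0 //.
Qed.

(** The divisor 1 + |x - y|^2 treats all distances n^g at once: it offsets the number of sites at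
    that distance up to logarithms, so the maximisation over g is done pair by pair. *)
Lemma plim_upper_bound (alpha beta : R) n x y T :
  0 < alpha -> alpha < 1 -> 0 < beta < 1 -> (1 < n)%N ->
  inb n x -> inb n y -> d x y <= (n%:R : R) `^ beta ->
  4 * alpha / pi * (ln n%:R) ^+ 2 <= T%:R ->
  plim n x y T <= 2 * expR 266 * expR ((rho2 alpha beta - 2) * ln n%:R) /
     (1 + nsq (subp x y)).
Proof.
move=> a0 a1 b01 n1 hx hy hd hT; have /andP[b0 b1] := b01.
have n0 : 0 < n%:R :> R by rewrite ltr0n; lia.
set L := ln n%:R in hT *.
have L0 : 0 < L by rewrite ln_gt0 // ltr1n.
have pi2 := pi_ge2 R; have pi4 : pi < 4 :> R by have := pihalf_lt2 R; lra.
have T0 : (0 < T)%N.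
  rewrite -(@ltr0n R); apply: lt_le_trans hT.
  by rewrite mulr_gt0 ?exprn_gt0 // divr_gt0; lra.
pose u := 1 + nsq (subp x y).
have u1 : 1 <= u by rewrite /u lerDl nsq_ge0.
pose l := ln u / 2.
have l0 : 0 <= l by rewrite /l divr_ge0 // ln_ge0.
have hl : l <= beta * L + 2^-1.
  move: hd; rewrite d_nsq ?powR_ge0 // -powR_mulrn ?powR_ge0 // -powRrM => hd.
  have p1 : 1 <= n%:R `^ (beta * 2%:R) :> R.
    by rewrite -[leLHS](powRr0 (n%:R : R)) ler_powR ?ler1n ?(ltnW n1) // mulr_ge0 // ltW.
  have : ln u <= ln (2 * n%:R `^ (beta * 2%:R)) by rewrite ler_ln ?posrE; [rewrite /u; lra|lra|lra].
  rewrite lnM ?posrE ?powR_gt0 // ln_powR -/L.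
  by have := ln2_le1 (R := R); rewrite /l; lra.
(* The 1 inside u can push l beyond beta L by up to 1/2; the truncation restores S >= (2 - beta) L,
   as [rho2_ge] requires. *)
pose l' := Num.min l (beta * L).
have l'l : l' <= l by rewrite /l' ge_min lexx.
have l'b : l' <= beta * L by rewrite /l' ge_min lexx orbT.
have ll' : l <= l' + 2^-1 by rewrite /l'; case: (leP l (beta * L)) => ?; lra.
pose S := 2 * L - l'.
have LS : L <= S by rewrite /S; nra.
have S0 : 0 < S by lra.
have SL : (2 - beta) * L <= S by rewrite /S; lra.
apply: le_trans (plim_le T0 hx hy) _.
have -> : 2 * expR 266 * expR ((rho2 alpha beta - 2) * L) / (1 + nsq (subp x y)) =
    2 * (expR 266 * expR ((rho2 alpha beta - 2) * L) / u) by rewrite -!mulrA.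
rewrite ler_pM2l //.
have -> : u^-1 = expR (- (2 * l)).
  have u0 : 0 < u by lra.
  by rewrite expRN /l mulrC divfK // lnK.
rewrite -!expRD ler_expR.
set D := 2 * pot_max n - _.
have M5 := @pot_max_ge5 R n.
have aM : pot (subp x y) <= pot_max n by apply: pot_le_max; exact: inbW.
have D0 : 0 < D by rewrite /D; lra.
(* The additive errors are 2 * 14 + 5 = 33, and 33 <= (2/pi) * 66 since pi < 4. *)
have hD : D <= 2 / pi * (S + 66).
  have hM := pot_max_le (ltnW n1).
  have := pot_bound (R := R) (subp x y); rewrite ler_norml => /andP[hp _].
  have e : ln (1 + nsq (subp x y)) = 2 * l by rewrite /l mulrC divfK.
  rewrite e in hp; rewrite /D.
  have ip0 : 0 < pi^-1 :> R by rewrite invr_gt0; lra.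
  have ip4 : 4^-1 <= pi^-1 :> R by rewrite lef_pV2 ?posrE; move: pi2 pi4; clear; lra.
  have h1 := ler_wpM2r (ltW ip0) l'l.
  move: hM hp h1 ip4; rewrite /S -/L; move: (pot_max n) (pot _) (pi^-1) => M a p.
  by lra.
have hq : 4 * alpha * L ^+ 2 / (S + 66) <= 2 * T%:R / D.
  rewrite ler_pdivlMr // mulrAC ler_pdivrMr; last by lra.
  apply: le_trans (_ : 4 * alpha * L ^+ 2 * (2 / pi * (S + 66)) <= _).
    by rewrite ler_wpM2l // mulr_ge0 ?sqr_ge0 //; lra.
  rewrite mulrA ler_pM2r; last by lra.
  by move: hT; clear; lra.
(* The difference is 4 * 66 * alpha * L^2 / (S (S + 66)), and S >= L. *)
have hr : 4 * alpha * L ^+ 2 / S - 264 <= 4 * alpha * L ^+ 2 / (S + 66).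
  have h1 : L ^+ 2 / (S * (S + 66)) <= 1.
    by rewrite ler_pdivrMr ?mul1r ?expr2; move: L0 LS S0; clear => *;
      [apply: ler_pM; lra|apply: mulr_gt0; lra].
  have -> : 4 * alpha * L ^+ 2 / S =
     4 * alpha * L ^+ 2 / (S + 66) + 264 * (alpha * (L ^+ 2 / (S * (S + 66)))).
    by clear - S0; field; lra.
  have h0 : 0 <= L ^+ 2 / (S * (S + 66)).
    by rewrite divr_ge0 ?sqr_ge0 //; apply: mulr_ge0; move: S0; clear; lra.
  have : alpha * (L ^+ 2 / (S * (S + 66))) <= 1 * 1.
    by apply: ler_pM => //; move: a0 a1; clear; lra.
  lra.
have hz : 4 * L - 2 * S - 4 * alpha * L ^+ 2 / S <= (rho2 alpha beta - 2) * L.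
  have hb : 2 - beta <= S / L by rewrite ler_pdivlMr.
  have := ler_wpM2r (ltW L0) (rho2_ge a0 b01 hb); apply: le_trans.
  rewrite le_eqVlt; apply/orP; left; apply/eqP.
  by clear - L0 S0; field; lra.
have eS : S = 2 * L - l' by [].
(* 266 = 1 + 264 + 1: from [plim_le], from [hr], and from twice the gap between l and l'. *)
have fin (A B C E s : R) : s = 2 * L - l' -> 4 * L - 2 * s - A <= E -> A - 264 <= B -> B <= C ->
    1 - C <= 266 + E + - (2 * l).
  by move: ll'; clear; lra.
exact: fin eS hz hr hq.
Qed.

Lemma big_box n (F : Z2 -> R) : \sum_(z <- box n) F z =
  \sum_(0 <= i < (2 * n).+1) \sum_(0 <= j < (2 * n).+1) F (i%:Z - n%:Z, j%:Z - n%:Z).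
Proof.
by rewrite /box big_allpairs_dep /index_iota subn0.
Qed.

Lemma harmonic_le m : \sum_(0 <= k < m.+1) (k.+1%:R)^-1 <= 1 + ln m.+1%:R :> R.
Proof.
elim: m => [|m IH]; first by rewrite big_nat1 ln1 invr1 addr0.
rewrite big_nat_recr //=; have := inv_le_lnB (R := R) m.
by move: (m.+2%:R^-1) (ln _) (ln _) IH => A B C; lra.
Qed.

Lemma sum_inv_dist_le m i : (i < m.+1)%N ->
  \sum_(0 <= j < m.+1) (1 + `|i%:R - j%:R|)^-1 <= 2 * (1 + ln m.+1%:R) :> R.
Proof.
move=> im; pose H := \sum_(0 <= k < m.+1) (k.+1%:R)^-1 : R.
apply: le_trans (_ : H + H <= _); last by have := harmonic_le m; rewrite /H; lra.
have sub k : (k <= m.+1)%N -> \sum_(0 <= k < k) (k.+1%:R)^-1 <= H.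
  move=> km; rewrite /H [leRHS](big_cat_nat (n := k)) //= lerDl.
  by apply: sumr_ge0 => ? _; rewrite invr_ge0.
rewrite (big_cat_nat (n := i.+1)) //=; apply: lerD.
  rewrite big_nat_rev /= add0n; apply: le_trans (sub i.+1 im).
  rewrite big_nat [leRHS]big_nat; apply: ler_sum => j /= ji.
  have -> : (i.+1 - j.+1 = i - j)%N by [].
  rewrite natrB; last by lia.
  have -> : i%:R - (i%:R - j%:R) = j%:R :> R by lra.
  by rewrite ger0_norm // addrC natr1.
rewrite -{1}[i.+1]add0n big_addn; apply: le_trans (sub (m.+1 - i.+1)%N _); last by lia.
apply: ler_sum => j _.
rewrite natrD -[i.+1%:R]natr1 ler_pV2 ?inE ?unitfE.
- have -> : i%:R - (j%:R + (i%:R + 1)) = - (j%:R + 1) :> R by lra.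
  by rewrite normrN ger0_norm ?addr_ge0 // -natr1 lerDr.
- by rewrite gt_eqF ?ltr_pwDl //= ltr_pwDl.
- by rewrite pnatr_eq0 ltr0n.
Qed.

(** Decouples the coordinates, so that the planar sum is bounded by a product of two harmonic sums,
    at the price of a second logarithm. *)
Lemma inv_nsq_le (a b : R) :
  (1 + (a ^+ 2 + b ^+ 2))^-1 <= 2 * ((1 + `|a|)^-1 * (1 + `|b|)^-1).
Proof.
have a0 := normr_ge0 a; have b0 := normr_ge0 b.
rewrite -(real_normK (num_real a)) -(real_normK (num_real b)).
move: `|a| `|b| a0 b0 => c e c0 e0; rewrite -invfM -[2]invrK -invfM.
have p0 : 0 < (1 + c) * (1 + e) by apply: mulr_gt0; lra.
have c2 := sqr_ge0 c; have e2 := sqr_ge0 e.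
rewrite lef_pV2 ?posrE; [|lra|by apply: mulr_gt0; rewrite ?invr_gt0; lra].
have := sqr_ge0 (c - e); have := sqr_ge0 (c - 1); have := sqr_ge0 (e - 1); lra.
Qed.

Lemma box_sum_inv n x : x \in box n ->
  \sum_(y <- box n) (1 + nsq (subp x y))^-1 <= 8 * (1 + ln (2 * n).+1%:R) ^+ 2.
Proof.
move=> /allpairsP[[i i'] []]; rewrite !mem_iota !add0n => /andP[_ hi] /andP[_ hi'] ->.
rewrite [(i, i').1]/= [(i, i').2]/= in hi hi' *.
rewrite big_box.
set h := 1 + ln _.
pose f k (j : nat) : R := (1 + `|k%:R - j%:R|)^-1.
apply: le_trans (_ : 2 * ((\sum_(0 <= j < (2 * n).+1) f i j) *
   (\sum_(0 <= j < (2 * n).+1) f i' j)) <= _).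
  rewrite mulr_suml mulr_sumr; apply: ler_sum => j _.
  rewrite !mulr_sumr; apply: ler_sum => j' _.
  apply: le_trans (inv_nsq_le (i%:R - j%:R) (i'%:R - j'%:R)).
  rewrite /sqnorm /subp /= le_eqVlt; apply/orP; left; apply/eqP; congr (_^-1).
  rewrite !rmorphD /= !rmorphXn /= !rmorphB /= -!pmulrn.
  congr (1 + (_ ^+ 2 + _ ^+ 2)); lra.
have f0 k : 0 <= \sum_(0 <= j < (2 * n).+1) f k j.
  by apply: sumr_ge0 => j _; rewrite invr_ge0 addr_ge0.
have h1 := sum_inv_dist_le hi; have h2 := sum_inv_dist_le hi'.
have -> : 8 * h ^+ 2 = 2 * ((2 * h) * (2 * h)) by lra.
by rewrite ler_wpM2l //; apply: ler_pM.
Qed.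

Lemma Epairs_upper (alpha beta : R) n :
  0 < alpha -> alpha < 1 -> 0 < beta < 1 -> (1 < n)%N ->
  Epairs alpha beta n <= 144 * expR 266 * expR (rho2 alpha beta * ln n%:R) *
     (4 + ln n%:R) ^+ 2.
Proof.
move=> a0 a1 b01 n1.
rewrite Epairs_plim //; set T := absz _.
have n1' : 1 <= n%:R :> R by rewrite ler1n; lia.
set L : R := ln n%:R.
have L0 : 0 <= L by rewrite ln_ge0.
have hT : 4 * alpha / pi * L ^+ 2 <= T%:R.
  apply: le_trans (ceil_ge _) _; rewrite -/L.
  rewrite -[T%:R]/((T%:Z)%:~R) ler_int /T abszE; exact: ler_norm.
set c : R := 2 * expR 266 * expR ((rho2 alpha beta - 2) * L).
have c0 : 0 <= c by rewrite !mulr_ge0 ?expR_ge0.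
apply: le_trans (_ : \sum_(x <- box n) c * (8 * (1 + ln (2 * n).+1%:R) ^+ 2) <= _).
  rewrite big_seq [leRHS]big_seq; apply: ler_sum => x xb.
  apply: le_trans (ler_wpM2l c0 (box_sum_inv xb)).
  rewrite mulr_sumr; apply: ler_sum => y _.
  have pos : 0 <= c * (1 + nsq (subp x y))^-1.
    by rewrite mulr_ge0 // invr_ge0 addr_ge0 // nsq_ge0.
  case: (boolP (inb n x)) => hx; last by rewrite mul0r.
  case: (boolP (inb n y)) => hy; last by rewrite mul0r.
  case: (boolP (d x y <= _)) => hd; last by rewrite mul0r.
  by rewrite mul1r; exact: plim_upper_bound.
rewrite big_box !sumr_const_nat subn0 -mulrnA -[leLHS]mulr_natr.
have -> : expR (rho2 alpha beta * L) = expR ((rho2 alpha beta - 2) * L) * n%:R ^+ 2.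
  have -> : (n%:R : R) ^+ 2 = expR (2 * L).
    by rewrite mulrC expRM_natr lnK // posrE; lra.
  by rewrite -expRD; congr expR; lra.
have hl : ln (2 * n).+1%:R <= 3 + L.
  apply: le_trans (_ : ln (3 * n%:R) <= _).
    by rewrite ler_ln ?posrE ?ltr0n // -?natr1 ?natrM; lra.
  by rewrite lnM ?posrE; [rewrite lerD2r; exact: ln_le_id|lra|lra].
have hl0 : 0 <= ln (2 * n).+1%:R :> R by rewrite ln_ge0 // ler1n.
have hn : ((2 * n).+1 * (2 * n).+1)%:R <= 9 * n%:R ^+ 2 :> R.
  by rewrite natrM -natr1 natrM; nra.
have sq : (1 + ln (2 * n).+1%:R) ^+ 2 <= (4 + L) ^+ 2.
  by rewrite lerXn2r ?nnegrE; lra.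
(* 144 = 2 * 8 * 9, where 9 n^2 bounds the number (2n + 1)^2 of sites of the box. *)
have -> : 144 * expR 266 * (expR ((rho2 alpha beta - 2) * L) * n%:R ^+ 2) * (4 + L) ^+ 2 =
  c * (8 * (4 + L) ^+ 2) * (9 * n%:R ^+ 2).
  by rewrite /c; lra.
apply: ler_pM => //.
  by rewrite mulr_ge0 // mulr_ge0 ?sqr_ge0.
by rewrite ler_wpM2l // ler_wpM2l.
Qed.

End Upper.

(** * Lower bound *)

Section Lower.
Context {R : realType}.
Implicit Types (w x y z : Z2) (n N i j : nat).
Local Notation pot := (@pot R).
Local Notation nsq := (@sqnorm R).

Lemma sum_nat_window (G : nat -> R) a s m : (forall i, 0 <= G i) -> (a + s <= m)%N ->
  \sum_(a <= i < a + s) G i <= \sum_(0 <= i < m) G i.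
Proof.
move=> G0 asm; rewrite [leRHS](big_cat_nat (n := a)) //=; last first.
  by apply: leq_trans asm; exact: leq_addr.
rewrite [X in _ + X](big_cat_nat (n := (a + s)%N)) ?leq_addr //=.
by rewrite addrCA lerDl addr_ge0 // sumr_ge0.
Qed.

Lemma box_sum_ge n (F : Z2 -> R) a b s c : (forall z, 0 <= F z) ->
  (a + s <= (2 * n).+1)%N -> (b + s <= (2 * n).+1)%N ->
  (forall i j, (a <= i < a + s)%N -> (b <= j < b + s)%N ->
     c <= F (i%:Z - n%:Z, j%:Z - n%:Z)) ->
  s%:R ^+ 2 * c <= \sum_(z <- box n) F z.
Proof.
move=> F0 ha hb hF; rewrite big_box.
apply: le_trans (sum_nat_window (fun i => _) ha); last first.
  by move=> i; exact: sumr_ge0.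
apply: le_trans (_ : \sum_(a <= i < a + s) s%:R * c <= _).
  by rewrite sumr_const_nat addKn -[leRHS]mulr_natl mulrA expr2.
rewrite big_nat [leRHS]big_nat; apply: ler_sum => i hi.
apply: le_trans (sum_nat_window (fun j => _) hb); last by move=> j; exact: F0.
apply: le_trans (_ : \sum_(b <= j < b + s) c <= _).
  by rewrite sumr_const_nat addKn -[leRHS]mulr_natl.
by rewrite big_nat [leRHS]big_nat; apply: ler_sum => j hj; exact: hF.
Qed.

Lemma pot_between z (lo hi : R) : 0 < lo -> lo <= 1 + nsq z -> 1 + nsq z <= hi ->
  ln lo / pi - 5 <= pot z <= ln hi / pi + 5.
Proof.
move=> lo0 hlo hhi; have ip0 : 0 < pi^-1 :> R by rewrite invr_gt0 pi_gt0.
have z0 := @nsq_ge0 R z.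
have h1 : ln lo * pi^-1 <= ln (1 + nsq z) * pi^-1.
  by rewrite ler_pM2r // ler_ln ?posrE; lra.
have h2 : ln (1 + nsq z) * pi^-1 <= ln hi * pi^-1.
  by rewrite ler_pM2r // ler_ln ?posrE; lra.
have := pot_bound (R := R) z; rewrite ler_norml => /andP[h3 h4].
by apply/andP; split; lra.
Qed.

Lemma ln_sqr (b : R) : 0 < b -> ln (b ^+ 2) = 2 * ln b.
Proof. by move=> b0; rewrite lnXn // mulr_natl. Qed.

Lemma lnZ_sqr (c b : R) : 0 < c -> 0 < b -> ln (c * b ^+ 2) = ln c + 2 * ln b.
Proof. by move=> c0 b0; rewrite (@lnM R c) ?posrE ?exprn_gt0 // ln_sqr. Qed.

Lemma ln_div_pi_le (c : R) : 1 <= c -> ln c / pi <= c / 2.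
Proof.
move=> c1; have pi2 := pi_ge2 R.
apply: ler_pM; rewrite ?ln_ge0 ?invr_ge0 ?pi_ge0 //; first by apply: ln_le_id; lra.
by rewrite lef_pV2 ?posrE //; lra.
Qed.

Lemma ln2_div_pi_le : ln 2 / (pi : R) <= 2^-1.
Proof.
have pi2 := pi_ge2 R; rewrite -[leRHS]mul1r.
apply: ler_pM; rewrite ?ln2_le1 ?ln_ge0 ?invr_ge0 ?pi_ge0 ?ler1n //.
by rewrite lef_pV2 ?posrE //; lra.
Qed.

Lemma pi_inv_bounds : 4^-1 <= (pi : R)^-1 <= 2^-1.
Proof.
have pi2 := pi_ge2 R; have pi4 := pihalf_lt2 R.
by rewrite !lef_pV2 ?posrE; lra.
Qed.

(** The term -ln K is the gain over the boundary values that later makes the harmonic functions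
    positive at the origin. *)
Lemma pot_origin_bound (K : R) n x : 2 <= K -> K <= n%:R ->
  (n%:R / (2 * K)) ^+ 2 <= nsq x -> nsq x <= 20 * (n%:R / K) ^+ 2 ->
  2 * (ln n%:R - ln K) / pi - 6 <= pot (subp (0, 0) x) <= 2 * (ln n%:R - ln K) / pi + 16.
Proof.
move=> K2 nK h1 h2; have K0 : 0 < K by lra.
have n0 : 0 < n%:R :> R by lra.
have e : nsq (subp (0, 0) x) = nsq x by rewrite /sqnorm /subp /= !sub0r !sqrrN.
have nK1 : 1 <= (n%:R / K) ^+ 2 by rewrite exprn_ege1 // ler_pdivlMr // mul1r.
have nK0 : 0 < n%:R / K by rewrite divr_gt0.
have n2K0 : 0 < n%:R / (2 * K) by rewrite divr_gt0 // mulr_gt0.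
have := @pot_between (subp (0, 0) x) ((n%:R / (2 * K)) ^+ 2) (21 * (n%:R / K) ^+ 2).
rewrite e => /(_ (exprn_gt0 2 n2K0)) h3.
have {}h3 := h3 ltac:(lra) ltac:(lra).
move: h3; rewrite lnZ_sqr // ln_sqr // !ln_div ?posrE ?mulr_gt0 // (@lnM R 2) ?posrE //.
have := @ln_div_pi_le 21 ltac:(lra); have := ln2_div_pi_le.
move: (ln 2) (ln 21) (ln n%:R) (ln K) (pi^-1) => A B L l p; clear.
by move=> h3 h4 /andP[h5 h6]; apply/andP; split; lra.
Qed.

Lemma pot_pair_bound (l : R) x y : 0 <= l ->
  (expR l / 6) ^+ 2 <= nsq (subp x y) -> nsq (subp x y) <= (expR l) ^+ 2 ->
  2 * (l / pi) - 23 <= pot (subp x y) <= 2 * (l / pi) + 6.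
Proof.
move=> l0 h1 h2; have W0 := expR_gt0 l.
have W1 : 1 <= expR l ^+ 2 by rewrite exprn_ege1 // -expR0 ler_expR.
have W60 : 0 < expR l / 6 by rewrite divr_gt0.
have := @pot_between (subp x y) ((expR l / 6) ^+ 2) (2 * expR l ^+ 2) (exprn_gt0 2 W60).
move=> h3; have {}h3 := h3 ltac:(lra) ltac:(lra).
move: h3; rewrite lnZ_sqr // ln_sqr // ln_div ?posrE // expRK.
have := ln2_div_pi_le.
have l6 := @ln_div_pi_le 6 ltac:(lra).
move: l6; move: (ln 2) (ln 6) (pi^-1) => A B p; clear.
by move=> h6 h4 /andP[h5 h7]; apply/andP; split; lra.
Qed.

Lemma pot_boundary_bound (K : R) n x z : 9 <= K -> 1 <= n%:R :> R ->
  ~~ inb n z -> inb n.+1 z -> nsq x <= 20 * (n%:R / K) ^+ 2 ->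
  2 * (ln n%:R / pi) - 7 <= pot (subp z x) <= 2 * (ln n%:R / pi) + 11.
Proof.
move=> K9 n1; rewrite !(@nsq_inb R) -ltNge -natr1 => z1 z2 hx.
have n0 : 0 < n%:R :> R by lra.
have N0 := sqr_ge0 (n%:R : R).
(* Since 20/81 <= 1/4, x stays within n/2 of the origin and its distance to z is comparable to n. *)
have nK2 : 20 * (n%:R / K) ^+ 2 <= 4^-1 * n%:R ^+ 2.
  have K81 : 81 <= K ^+ 2 by rewrite expr2; clear - K9; nra.
  rewrite expr_div_n mulrA ler_pdivrMr; last by lra.
  have := ler_wpM2l N0 K81; lra.
have h1 : 4^-1 * n%:R ^+ 2 <= 1 + nsq (subp z x).
  pose u : Z2 := (- x.1, - x.2); have := @nsq_sub R (subp z x) u.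
  have -> : subp (subp z x) u = z.
    by case: (z) => ? ?; rewrite /subp /= !opprK !subrK.
  have -> : nsq u = nsq x by rewrite /sqnorm /= !sqrrN.
  by move: hx nK2 z1; lra.
have h2 : 1 + nsq (subp z x) <= 11 * n%:R ^+ 2.
  have nn : n%:R <= n%:R ^+ 2 :> R by rewrite expr2 ler_peMr //; lra.
  by have := @nsq_sub R z x; lra.
have n2 : 0 < 4^-1 * n%:R ^+ 2 :> R by rewrite mulr_gt0 ?exprn_gt0.
have := pot_between n2 h1 h2.
rewrite !lnZ_sqr // lnV ?posrE //.
have := @ln_div_pi_le 4 ltac:(lra); have := @ln_div_pi_le 11 ltac:(lra).
move: (ln 4) (ln 11) (ln n%:R) (pi^-1) => A B L p; clear.
by move=> h3 h4 /andP[h5 h6]; apply/andP; split; lra.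
Qed.

(** Here p stands for 1/pi. The four powers of L come from 1/m, from q and from 1/(t + 1), the last
    of order L^-2; 96 = 2 * 16 * 3 collects their constants. *)
Lemma trace_weight_ge (alpha g p L c0 a m : R) t :
  0 < alpha < 1 -> 0 < g < 1 -> 4^-1 <= p <= 2^-1 -> 1 <= L -> 0 <= c0 -> 4 * (c0 + 1) <= L ->
  m = 2 * (2 * (L * p) - g * (L * p)) - c0 ->
  1 <= a -> (1 - g) * L / 2 <= m - a ->
  t.+1%:R <= 4 * alpha * p * L ^+ 2 + 1 ->
  (1 - g) / 96 * expR (- (16 * (c0 + 1))) / L ^+ 4 * expR (- (4 * alpha * L / (2 - g)))
    <= m^-1 * ((a^-1 - m^-1) / 2 * (1 - m^-1) ^+ (2 * t) / t.+1%:R).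
Proof.
move=> /andP[a0 a1] /andP[g0 g1] /andP[p4 p2] L1 c00 Lc em a_ge1 mma ht.
have p0 : 0 < p by lra.
have aa0 : 0 < a by lra.
have gL0 : 0 < (1 - g) * L by rewrite mulr_gt0; lra.
have am : a <= m by clear - mma gL0; lra.
have m0 : 0 < m by lra.
have mL : m <= 2 * L.
  have : L * p <= L * 2^-1 by rewrite ler_wpM2l //; lra.
  have : 0 <= g * (L * p) by rewrite !mulr_ge0 //; lra.
  by rewrite em; clear - c00; lra.
have im : (2 * L)^-1 <= m^-1 by rewrite lef_pV2 ?posrE //; lra.
have q1 : (1 - g) / (16 * L) <= (a^-1 - m^-1) / 2.
  have -> : (a^-1 - m^-1) / 2 = (m - a) / (2 * (m * a)) by clear - m0 aa0; field; lra.
  rewrite ler_pdivlMr; last by rewrite !mulr_gt0.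
  apply: le_trans mma; rewrite mulrAC ler_pdivrMr; last by lra.
  have : m * a <= (2 * L) * (2 * L).
    by apply: ler_pM; rewrite ?(ltW m0) ?(ltW aa0) ?(le_trans am mL).
  have g12 : 0 <= 2 * (1 - g) by lra.
  move=> /(ler_wpM2l g12).
  by clear; lra.
have z1 : 1 <= 2 - g by lra.
have mm1 : 2 * p * ((2 - g) * L - 2 * (c0 + 1)) <= m - 1.
  have : (c0 + 1) * 4^-1 <= (c0 + 1) * p by rewrite ler_wpM2l //; lra.
  by rewrite em; clear; lra.
have zL : 1 * L <= (2 - g) * L by rewrite ler_wpM2r //; lra.
have c1L : 2 * (c0 + 1) < (2 - g) * L by lra.
have den0 : 0 < (2 - g) * L - 2 * (c0 + 1) by lra.
have mm0 : 0 < m - 1 by apply: lt_le_trans mm1; rewrite !mulr_gt0.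
(* The shift of m by c0 + 1 changes this quotient, of order L, only by a bounded amount, thanks to 4
   (c0 + 1) <= L. *)
have t2 : 2 * t%:R / (m - 1) <= 4 * alpha * L / (2 - g) + 16 * (c0 + 1).
  apply: le_trans (_ : 8 * alpha * p * L ^+ 2 / (2 * p * ((2 - g) * L - 2 * (c0 + 1))) <= _).
    apply: ler_pM => //.
    - by rewrite invr_ge0 ltW.
    - by move: ht; rewrite -natr1; clear; lra.
    - by rewrite lef_pV2 ?posrE // !mulr_gt0.
  have -> : 8 * alpha * p * L ^+ 2 / (2 * p * ((2 - g) * L - 2 * (c0 + 1))) =
    4 * alpha * (L ^+ 2 / ((2 - g) * L - 2 * (c0 + 1))).
    by move: den0; clear - p0; move: ((2 - g) * L) => B h; field; lra.
  have : L ^+ 2 / ((2 - g) * L - 2 * (c0 + 1)) <= L / (2 - g) + 4 * (c0 + 1).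
    rewrite ler_pdivrMr //.
    have -> : (L / (2 - g) + 4 * (c0 + 1)) * ((2 - g) * L - 2 * (c0 + 1)) =
      L ^+ 2 + 2 * (c0 + 1) * (2 * (2 - g) * L - L / (2 - g) - 4 * (c0 + 1)).
      by clear - z1; field; lra.
    rewrite lerDl mulr_ge0 //; first by lra.
    have : L / (2 - g) <= L by rewrite ler_pdivrMr ?ler_peMr //; lra.
    by move: zL Lc; move: (L / _) => B; clear; lra.
  have a4 : 0 <= 4 * alpha by lra.
  move=> /(ler_wpM2l a4) h.
  apply: le_trans h _.
  have : alpha * (c0 + 1) <= 1 * (c0 + 1).
    by rewrite ler_wpM2r //; move: a1 c00; clear; lra.
  by rewrite mulrDr -!mulrA; move: (L / _) => B; clear; lra.
have ex : expR (- (16 * (c0 + 1))) * expR (- (4 * alpha * L / (2 - g))) <=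
    (1 - m^-1) ^+ (2 * t).
  apply: le_trans (_ : expR (- (m - 1)^-1) ^+ (2 * t) <= _).
    rewrite -expRD -expRM_natl ler_expR natrM.
    by move: t2; move: (_ / (2 - g)) ((m - 1)^-1) => B C; clear; lra.
  (* Written as the inverse of 1 + 1/(m - 1), the factor is bounded below through 1 + u <= exp u. *)
  have h1 : 1 - m^-1 = (m / (m - 1))^-1 by clear - m0 mm0; field; lra.
  rewrite h1 expRN lerXn2r ?nnegrE ?invr_ge0 ?expR_ge0 //; first by rewrite divr_ge0 // ltW.
  rewrite lef_pV2 ?posrE ?expR_gt0 ?divr_gt0 //.
  have -> : m / (m - 1) = 1 + (m - 1)^-1 by clear - mm0; field; lra.
  exact: expR_ge1Dx.
have tL : (3 * L ^+ 2)^-1 <= (t.+1%:R)^-1.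
  have L2 : 1 <= L ^+ 2 by rewrite exprn_ege1.
  rewrite lef_pV2 ?posrE ?ltr0n //; last by lra.
  apply: le_trans ht _.
  have : alpha * p <= 1 * 2^-1 by apply: ler_pM; move: a0 a1 p0 p2; clear; lra.
  have L4 : 0 <= 4 * L ^+ 2 by lra.
  move=> /(ler_wpM2r L4).
  by move: L2; clear; lra.
have -> : (1 - g) / 96 * expR (- (16 * (c0 + 1))) / L ^+ 4 * expR (- (4 * alpha * L / (2 - g))) =
  (2 * L)^-1 * ((1 - g) / (16 * L) *
    (expR (- (16 * (c0 + 1))) * expR (- (4 * alpha * L / (2 - g)))) * (3 * L ^+ 2)^-1).
  by clear - L1; move: (expR _) (expR _) => A B; field; lra.
have e0 (u v : R) : 0 <= expR u * expR v by rewrite mulr_ge0 ?expR_ge0.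
have g10 : 0 <= (1 - g) / (16 * L) by apply: divr_ge0; move: g1 L1; clear; lra.
have L20 : 0 <= (3 * L ^+ 2)^-1 by rewrite invr_ge0 mulr_ge0 ?sqr_ge0.
apply: ler_pM => //; first by rewrite invr_ge0; lra.
  by apply: mulr_ge0 => //; exact: mulr_ge0.
apply: ler_pM => //; first exact: mulr_ge0.
by apply: ler_pM.
Qed.

(** The 20 in [c0] is 7 + 7 + 6, the errors of the three kernel values at the boundary; 72/g is
    (4/g) * 18, with 18 the spread 11 + 7 there and 4/g a bound for m/a. At the origin the spread is
    16 + 6 = 22, whence 88/g, and 57 = 16 + 16 + 23 + 2; the final 2, halved, leaves [kap] = 1/m. *)
Lemma plim_lower_bound (alpha g K : R) n x y t :
  let L := ln n%:R : R in let c0 := 20 + 72 / g in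
  0 < alpha < 1 -> 0 < g < 1 -> 9 <= K -> c0 + 57 + 88 / g <= ln K ->
  1 <= L -> 92 <= g * L -> 2 * (c0 + 6) <= (1 - g) * L -> 4 * (c0 + 1) <= L ->
  K <= n%:R ->
  x != y -> inb n x -> inb n y ->
  (n%:R / (2 * K)) ^+ 2 <= nsq x -> nsq x <= 20 * (n%:R / K) ^+ 2 ->
  (n%:R / (2 * K)) ^+ 2 <= nsq y -> nsq y <= 20 * (n%:R / K) ^+ 2 ->
  (expR (g * L) / 6) ^+ 2 <= nsq (subp x y) ->
  nsq (subp x y) <= (expR (g * L)) ^+ 2 ->
  t.+1%:R <= 4 * alpha / pi * L ^+ 2 + 1 ->
  (1 - g) / 96 * expR (- (16 * (c0 + 1))) / L ^+ 4 * expR (- (4 * alpha * L / (2 - g)))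
    <= plim n x y t.+1.
Proof.
move=> L c0 a01 g01 K9 hK L1 gL gL1 Lc nK xy inx iny xlo xhi ylo yhi dlo dhi ht.
have /andP[g0 g1] := g01.
have K2 : 2 <= K by lra.
have n1 : 1 <= n%:R :> R by lra.
have gL0 : 0 <= g * L by lra.
have /andP[nx1 nx2] := pot_origin_bound K2 nK xlo xhi.
have /andP[ny1 ny2] := pot_origin_bound K2 nK ylo yhi.
have /andP[alo ahi] := pot_pair_bound gL0 dlo dhi.
have far z hz1 hz2 := @pot_boundary_bound K n x z K9 n1 hz1 hz2 xhi.
have far' z hz1 hz2 := @pot_boundary_bound K n y z K9 n1 hz1 hz2 yhi.
move: nx1 nx2 ny1 ny2 alo ahi far far'.
rewrite -/L; have := pi_inv_bounds; move: ht.
set p : R := pi^-1; set a := pot (subp x y) => ht p42.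
have /andP[p4 p2] := p42.
move: xlo xhi ylo yhi dlo dhi => _ _ _ _ _ _.
rewrite -[g * L * p]mulrA -![2 * (_ - _) * p]mulrA.
set l := ln K in hK *.
move=> nx1 nx2 ny1 ny2 alo ahi far far'.
have c20 : 20 <= c0 by rewrite /c0 lerDl divr_ge0 // ltW.
have l0 : 0 <= l by have : 0 <= 88 / g by [rewrite divr_ge0 // ltW]; lra.
have Lp : 4^-1 * L <= L * p by rewrite mulrC ler_wpM2l //; lra.
have gLp : g * (4^-1 * L) <= g * (L * p) by rewrite ler_wpM2l // ltW.
have g1Lp : (1 - g) * (4^-1 * L) <= (1 - g) * (L * p) by rewrite ler_wpM2l //; lra.
pose m := 2 * (2 * (L * p) - g * (L * p)) - c0.
have agL : g * (L * p) <= a by clear - alo gLp gL; lra.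
have a1 : 1 <= a by clear - agL gLp gL; lra.
have mma : (1 - g) * L / 2 <= m - a by rewrite /m; clear - ahi g1Lp gL1; lra.
have gL2 : 0 <= (1 - g) * L by apply: mulr_ge0; move: g1 L1; clear; lra.
have am : a <= m by clear - mma gL2; lra.
have m4 : m <= 4 * (L * p) by rewrite /m; clear - gLp gL c20; lra.
have m0 : 0 < m by clear - am a1; lra.
have aa0 : 0 < a by clear - a1; lra.
have im0 : 0 < m^-1 by rewrite invr_gt0.
(* m is at most 4L/pi, while a is at least g L/pi because 92 <= g L absorbs the error 23. *)
have ratio : a^-1 <= 4 / g * m^-1.
  rewrite -(ler_pM2l g0) mulrA [g * (4 / g)]mulrCA divff ?gt_eqF // mulr1.
  rewrite ler_pdivrMr // mulrAC ler_pdivlMr //.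
  apply: le_trans (_ : g * (4 * (L * p)) <= _); first by rewrite ler_wpM2l // ltW.
  by clear - agL; lra.
have key := @plim_ge R n x y t m m^-1 xy inx iny.
rewrite -/a in key.
apply: le_trans (key a1 am _ (ltW im0) _).
- apply: (@trace_weight_ge alpha g p L c0 a m t) => //; lra.
- move=> z z1 z2.
  have /andP[fx1 fx2] := far z z1 z2; have /andP[fy1 fy2] := far' z z1 z2.
  have d18 : `|pot (subp z y) - pot (subp z x)| <= 18.
    by rewrite ler_norml; clear - fx1 fx2 fy1 fy2; apply/andP; split; lra.
  apply: le_trans (_ : 72 / g * m^-1 <= _).
    apply: le_trans (_ : 18 * a^-1 <= _); first by rewrite ler_pM2r ?invr_gt0.
    by clear - ratio; move: (a^-1) (m^-1) (g^-1) ratio => A B C; lra.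
  have mn0 : m != 0 by rewrite gt_eqF.
  rewrite lerBrDr ler_pdivlMr // mulrDl mul1r divfK //.
  rewrite /m /c0; move: fx1 fy1 ahi; clear; lra.
rewrite ler_pdivlMr //.
have d22 : `|pot (subp (0, 0) y) - pot (subp (0, 0) x)| <= 22.
  by rewrite ler_norml; clear - nx1 nx2 ny1 ny2; apply/andP; split; lra.
have h1 : `|pot (subp (0, 0) y) - pot (subp (0, 0) x)| / a <= 88 / g * m^-1.
  apply: le_trans (_ : 22 * a^-1 <= _); first by rewrite ler_pM2r ?invr_gt0.
  by clear - ratio; move: (a^-1) (m^-1) (g^-1) ratio => A B C; lra.
have lp : l * 4^-1 <= l * p by rewrite ler_wpM2l.
have h2 : (pot (subp (0, 0) x) + pot (subp (0, 0) y) - a) / m <=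
   1 - (2 + 88 / g) * m^-1.
  have mn0 : m != 0 by rewrite gt_eqF.
  rewrite ler_pdivrMr // mulrBl mul1r divfK //.
  by move: lp hK nx2 ny2 alo; rewrite /m; clear; lra.
by move: h1 h2; clear; lra.
Qed.
End Lower.

(** * Choice of scales and summation over pairs *)

Section LowerSum.
Context {R : realType}.
Implicit Types (w x y z : Z2) (n N i j : nat).
Local Notation nsq := (@sqnorm R).

(** The maximiser is beta or 2 - sqrt(2 alpha). The latter is positive because alpha < 1, and below
    1 because its branch makes it smaller than beta. *)
Lemma rho2_attained (alpha beta : R) : 0 < alpha < 1 -> 0 < beta < 1 ->
  exists g, [/\ 0 < g, g < 1, g <= beta &
    rho2 alpha beta = 2 + 2 * g - 4 * alpha / (2 - g)].
Proof.
move=> /andP[a0 a1] /andP[b0 b1]; set s := Num.sqrt (2 * alpha).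
have s0 : 0 < s by rewrite sqrtr_gt0; lra.
have s2 : s ^+ 2 = 2 * alpha by rewrite sqr_sqrtr; lra.
have s_lt2 : s < 2 by rewrite ltNge; apply/negP => h; nra.
rewrite /rho2 -/s; case: leP => [h|h]; first by exists beta; split.
exists (2 - s); split; rewrite ?(ltW h) //; [lra|lra|].
have -> : 4 * alpha = 2 * s ^+ 2 by rewrite s2; lra.
have -> : 2 - (2 - s) = s by lra.
by clear - s0; field; lra.
Qed.

Lemma nsq_grid (a b n : nat) : nsq (a%:Z - n%:Z, b%:Z - n%:Z) =
  (a%:R - n%:R) ^+ 2 + (b%:R - n%:R) ^+ 2.
Proof. by rewrite /sqnorm /= rmorphD /= !rmorphXn /= !rmorphB. Qed.

Lemma sum_sqr_bounds (u v lo r c1 c2 : R) : 0 <= lo -> lo <= r -> r <= u -> u <= c1 * r ->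
  0 <= v -> v <= c2 * r -> 0 <= c1 -> 0 <= c2 -> c1 ^+ 2 + c2 ^+ 2 <= 20 ->
  lo ^+ 2 <= u ^+ 2 + v ^+ 2 <= 20 * r ^+ 2.
Proof.
move=> lo0 lor ru uc v0 vc c10 c20 cc.
have r0 : 0 <= r by lra.
have h1 : lo ^+ 2 <= u ^+ 2 by rewrite lerXn2r ?nnegrE; lra.
have h2 : u ^+ 2 <= (c1 * r) ^+ 2 by rewrite lerXn2r ?nnegrE ?mulr_ge0 //; lra.
have h3 : v ^+ 2 <= (c2 * r) ^+ 2 by rewrite lerXn2r ?nnegrE ?mulr_ge0 //; lra.
have h4 := sqr_ge0 v; have := ler_wpM2r (sqr_ge0 r) cc.
by move: h1 h2 h3 h4; clear; rewrite !exprMn => *; apply/andP; split; lra.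
Qed.

(** With r = n/K and P about n^g/3 (both rounded down), x runs over [r, 2r) x [0, r) and y over x +
    [P, 2P) x [0, P). These r^2 P^2 pairs stay at distance of order n/K from the origin and of order
    n^g from each other. *)
Lemma Epairs_lower_at (alpha beta g : R) n K :
  let L := ln n%:R : R in let c0 := 20 + 72 / g in
  0 < alpha < 1 -> 0 < g < 1 -> g <= beta -> (9 <= K)%N ->
  c0 + 57 + 88 / g <= ln K%:R ->
  1 <= L -> 92 <= g * L -> 2 * (c0 + 6) <= (1 - g) * L -> 4 * (c0 + 1) <= L ->
  ln (2 * K%:R) <= (1 - g) * L ->
  (n%:R / (2 * K%:R)) ^+ 2 * ((expR (g * L) / 6) ^+ 2 *
    ((1 - g) / 96 * expR (- (16 * (c0 + 1))) / L ^+ 4 * expR (- (4 * alpha * L / (2 - g)))))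
   <= Epairs alpha beta n.
Proof.
move=> L c0 a01 g01 gb K9 hK L1 gL gL1 Lc LK.
have /andP[a0 a1] := a01; have /andP[g0 g1] := g01.
rewrite Epairs_plim //; set T := absz _; set V := _ * expR (- (_ / (2 - g))).
have V0 : 0 <= V.
  rewrite /V mulr_ge0 ?expR_ge0 // divr_ge0 ?exprn_ge0 //; last by lra.
  by rewrite mulr_ge0 ?expR_ge0 // divr_ge0 //; lra.
have n0 : 0 < n%:R :> R.
  rewrite ltNge; apply/negP => h; move: L1; rewrite /L ln0 //; lra.
have K0 : 0 < K%:R :> R by rewrite ltr0n; apply: leq_trans K9.
set W := expR (g * L).
have WK : 2 * K%:R * W <= n%:R.
  rewrite -[leRHS]lnK ?posrE // -[2 * K%:R]lnK ?posrE ?mulr_gt0 // -expRD ler_expR -/L.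
  by move: LK; clear; lra.
have W92 : 93 <= W.
  by apply: le_trans (expR_ge1Dx _); move: gL; clear; lra.
pose r := (n %/ K)%N.
have rK : r%:R * K%:R <= n%:R :> R by rewrite -natrM ler_nat leq_trunc_div.
have r_le : r%:R <= n%:R / K%:R :> R by rewrite ler_pdivlMr.
have r_ge : n%:R / (2 * K%:R) <= r%:R :> R.
  have : n%:R <= (r%:R + 1) * K%:R :> R.
    rewrite natr1 -natrM ler_nat ltnW // ltn_ceil //.
    by apply: leq_trans K9.
  have : K%:R * 93 <= K%:R * W by rewrite ler_wpM2l // ltW.
  rewrite ler_pdivrMr ?mulr_gt0 //; move: WK K0; clear; lra.
(* The divisor 3 gives |x - y|^2 <= (4 + 1) W^2/9 <= W^2. *)
have [P /andP[P_le P_gt]] : exists P : nat, P%:R <= W / 3 < P.+1%:R.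
  by exists (Num.trunc (W / 3)); apply: truncn_itv; rewrite divr_ge0 // expR_ge0.
have P_ge : W / 6 <= P%:R by move: P_gt W92; rewrite -[P.+1%:R]natr1; clear; lra.
have Pr : (P <= r)%N.
  rewrite -(ler_nat R); apply: le_trans P_le (le_trans _ r_ge).
  rewrite ler_pdivlMr ?mulr_gt0 //.
  have : 0 <= K%:R * W by rewrite mulr_ge0 ?ltW // expR_gt0.
  by move: WK; clear; lra.
have P0 : (0 < P)%N by rewrite -(ltr0n R); move: P_ge W92; clear; lra.
have nr : (9 * r <= n)%N.
  by apply: leq_trans (leq_trunc_div n K); rewrite mulnC leq_mul2l K9 orbT.
have pi0 := pi_gt0 R.
have x0 : 0 < 4 * alpha / pi * L ^+ 2.
  by rewrite mulr_gt0 ?exprn_gt0 ?divr_gt0 ?mulr_gt0 //; lra.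
have /andP[c_lt c_ge] := ceil_itv (4 * alpha / pi * L ^+ 2).
have cT : Num.ceil (4 * alpha / pi * L ^+ 2) = T%:Z.
  by rewrite /T gez0_abs // -(ler0z R); apply: ltW (lt_le_trans x0 c_ge).
have [t eT] : exists t, T = t.+1.
  exists T.-1; rewrite prednK // -(ltr0n R); apply: lt_le_trans x0 _.
  by move: c_ge; rewrite cT.
have ht : t.+1%:R <= 4 * alpha / pi * L ^+ 2 + 1 :> R.
  by move: c_lt; rewrite cT eT rmorphB /= -pmulrn => h; apply: ltW; move: h; clear; lra.
have lo0 : 0 <= n%:R / (2 * K%:R) :> R by rewrite divr_ge0 // mulr_ge0.
have K9' : 9 <= K%:R :> R by rewrite (ler_nat R 9).
have KN : K%:R <= n%:R :> R.
  apply: le_trans WK; have : K%:R * 93 <= K%:R * W by rewrite ler_wpM2l // ltW.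
  by move: K0; clear; lra.
have in_disc z : nsq z <= 20 * r%:R ^+ 2 -> inb n z.
  rewrite (@nsq_inb R) => /le_trans; apply.
  have : 81 * r%:R ^+ 2 <= n%:R ^+ 2 :> R.
    have -> : 81 * r%:R ^+ 2 = (9 * r%:R) ^+ 2 :> R by ring.
    by rewrite lerXn2r ?nnegrE ?mulr_ge0 // -natrM ler_nat.
  by have := sqr_ge0 (r%:R : R); clear; lra.
have up20 (u : R) : u <= 20 * r%:R ^+ 2 -> u <= 20 * (n%:R / K%:R) ^+ 2.
  move=> /le_trans; apply; apply: ler_wpM2l => //.
  by apply: lerXn2r => //; rewrite nnegrE // divr_ge0.
apply: le_trans (_ : r%:R ^+ 2 * (P%:R ^+ 2 * V) <= _).
  apply: ler_pM; [exact: sqr_ge0|by apply: mulr_ge0; rewrite ?sqr_ge0| |].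
    by apply: lerXn2r => //; rewrite nnegrE.
  apply: ler_wpM2r => //; apply: lerXn2r => //; rewrite nnegrE //.
  by rewrite divr_ge0 // expR_ge0.
have F0 x y : 0 <= [&& inb n x, inb n y & d x y <= n%:R `^ beta]%:R * plim n x y T.
  rewrite mulr_ge0 //; apply: limr_ge; first by apply: cvgP; exact: cvg_pu.
  by apply: nearW => N; exact: pu_ge0.
apply: (@box_sum_ge R n _ (n + r)%N n r) => [x|||i j /andP[i1 i2] /andP[j1 j2]].
- by apply: sumr_ge0 => y _; exact: F0.
- by move: nr; clear; lia.
- by move: nr; clear; lia.
apply: (@box_sum_ge R n _ (i + P)%N j P) => [y|||i' j' /andP[i1' i2'] /andP[j1' j2']].
- exact: F0.
- by move: i2 nr Pr; clear; lia.
- by move: j2 nr Pr; clear; lia.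
set x : Z2 := (i%:Z - n%:Z, j%:Z - n%:Z); set y : Z2 := (i'%:Z - n%:Z, j'%:Z - n%:Z).
have i1R : n%:R + r%:R <= i%:R :> R by rewrite -natrD ler_nat.
have i2R : i%:R <= n%:R + r%:R + r%:R :> R by rewrite -!natrD ler_nat ltnW.
have j1R : n%:R <= j%:R :> R by rewrite ler_nat.
have j2R : j%:R <= n%:R + r%:R :> R by rewrite -!natrD ler_nat ltnW.
have i1R' : i%:R + P%:R <= i'%:R :> R by rewrite -natrD ler_nat.
have i2R' : i'%:R <= i%:R + P%:R + P%:R :> R by rewrite -!natrD ler_nat ltnW.
have j1R' : j%:R <= j'%:R :> R by rewrite ler_nat.
have j2R' : j'%:R <= j%:R + P%:R :> R by rewrite -!natrD ler_nat ltnW.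
have PrR : P%:R <= r%:R :> R by rewrite ler_nat.
have r0 : 0 <= r%:R :> R by [].
have P0R : 0 <= P%:R :> R by [].
have /andP[xlo xhi] : (n%:R / (2 * K%:R)) ^+ 2 <= nsq x <= 20 * r%:R ^+ 2.
  rewrite nsq_grid; apply: (@sum_sqr_bounds _ _ _ _ 2 1) => //.
  - by move: i1R; clear; lra.
  - by move: i2R; clear; lra.
  - by move: j1R; clear; lra.
  - by move: j2R; clear; lra.
  - by lra.
have /andP[ylo yhi] : (n%:R / (2 * K%:R)) ^+ 2 <= nsq y <= 20 * r%:R ^+ 2.
  (* As P <= r, the coordinates of y are at most 4r and 2r; 4^2 + 2^2 is the 20 in the distance
     bounds. *)
  rewrite nsq_grid; apply: (@sum_sqr_bounds _ _ _ _ 4 2) => //.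
  - by move: i1R i1R' P0R; clear; lra.
  - by move: i2R i2R' PrR; clear; lra.
  - by move: j1R j1R'; clear; lra.
  - by move: j2R j2R' PrR; clear; lra.
  - by lra.
have dxy : nsq (subp x y) = (i'%:R - i%:R) ^+ 2 + (j'%:R - j%:R) ^+ 2.
  by rewrite /sqnorm /subp /= rmorphD /= !rmorphXn /= !rmorphB /=; ring.
have W60 : 0 <= W / 6 by rewrite divr_ge0 // expR_ge0.
have /andP[dlo dhi] : (W / 6) ^+ 2 <= nsq (subp x y) <= W ^+ 2.
  have h1 : (W / 6) ^+ 2 <= (i'%:R - i%:R) ^+ 2.
    rewrite lerXn2r ?nnegrE //; move: i1R' P_ge P0R; clear; lra.
  have h2 : (i'%:R - i%:R) ^+ 2 <= (2 * (W / 3)) ^+ 2.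
    by rewrite lerXn2r ?nnegrE //; move: i1R' i2R' P_le P0R; clear; lra.
  have h3 : (j'%:R - j%:R) ^+ 2 <= (W / 3) ^+ 2.
    by rewrite lerXn2r ?nnegrE //; move: j1R' j2R' P_le P0R; clear; lra.
  have := sqr_ge0 (j'%:R - j%:R : R); have := sqr_ge0 W.
  by rewrite dxy; move: h1 h2 h3; clear => *; apply/andP; split; lra.
have xD := in_disc x xhi; have yD := in_disc y yhi.
have -> : d x y <= (n%:R : R) `^ beta.
  rewrite d_nsq ?powR_ge0 //; apply: le_trans dhi _.
  rewrite lerXn2r ?nnegrE ?powR_ge0 ?expR_ge0 //.
  rewrite /powR gt_eqF // ler_expR -/L ler_wpM2r //; lra.
rewrite xD yD mul1r eT.
apply: (@plim_lower_bound R alpha g K%:R n x y t) => //; rewrite ?up20 //.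
by rewrite xpair_eqE; move: i1' P0; clear; lia.
Qed.

Lemma Epairs_lower (alpha beta : R) : 0 < alpha < 1 -> 0 < beta < 1 ->
  exists c A : R, 0 < c /\ forall n, A <= ln n%:R ->
    c * expR (rho2 alpha beta * ln n%:R) / (ln n%:R) ^+ 4 <= Epairs alpha beta n.
Proof.
move=> a01 b01; have [g [g0 g1 gb erho]] := rho2_attained a01 b01.
pose c0 := 20 + 72 / g; pose K := maxn 9 (Num.trunc (expR (c0 + 57 + 88 / g))).+1.
have ig0 : 0 < g^-1 by rewrite invr_gt0.
have c20 : 20 <= c0 by rewrite /c0 lerDl divr_ge0 // ltW.
have K9 : (9 <= K)%N by rewrite leq_maxl.
have K0 : 0 < K%:R :> R by rewrite ltr0n (leq_trans _ K9).
have hK : c0 + 57 + 88 / g <= ln K%:R.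
  rewrite -[leLHS]expRK ler_ln ?posrE ?expR_gt0 //.
  have /andP[_ /ltW h] := truncn_itv (expR_ge0 (c0 + 57 + 88 / g)).
  by apply: le_trans h _; rewrite ler_nat leq_maxr.
have l0 : 0 <= ln (2 * K%:R) :> R.
  by rewrite ln_ge0 // -natrM ler1n muln_gt0 /= (leq_trans _ K9).
pose C := (1 - g) / 96 * expR (- (16 * (c0 + 1))).
have C0 : 0 < C by rewrite mulr_gt0 ?expR_gt0 // divr_gt0 //; lra.
pose B := (2 * c0 + 12 + ln (2 * K%:R)) / (1 - g).
have B0 : 0 <= B by apply: divr_ge0; lra.
have i92 : 0 <= 92 / g by rewrite divr_ge0 // ltW.
(* 4 K^2 and 36 are the squares of the losses 2K and 6 in the side lengths of the two windows. *)
exists (C / (4 * K%:R ^+ 2 * 36)), (1 + 92 / g + B + 4 * (c0 + 1)).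
split; first by rewrite divr_gt0 // !mulr_gt0.
move=> n; set L := ln n%:R => hL.
have L1 : 1 <= L by lra.
have n0 : 0 < n%:R :> R.
  rewrite ltNge; apply/negP => h; move: L1; rewrite /L ln0 //; lra.
have gL : 92 <= g * L by rewrite mulrC -ler_pdivrMr //; lra.
have gL1 : 2 * c0 + 12 + ln (2 * K%:R) <= (1 - g) * L.
  have BL : B <= L by lra.
  have g10 : 0 < 1 - g by lra.
  by rewrite [_ * L]mulrC -ler_pdivrMr.
have g01 : 0 < g < 1 by rewrite g0.
have h1 : 2 * (c0 + 6) <= (1 - g) * L by move: gL1 l0; clear; lra.
have h2 : 4 * (c0 + 1) <= L by move: hL i92 B0; clear; lra.
have h3 : ln (2 * K%:R) <= (1 - g) * L by move: gL1 c20; clear; lra.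
apply: le_trans (Epairs_lower_at a01 g01 gb K9 hK L1 gL h1 h2 h3).
rewrite -/c0 -/L -/C le_eqVlt; apply/orP; left; apply/eqP.
have -> : rho2 alpha beta * L = L + L + (g * L + g * L) + - (4 * alpha * L / (2 - g)).
  by rewrite erho; clear - g1; field; lra.
rewrite !expRD [expR L]lnK ?posrE //.
move: (expR (g * L)) (expR (- _)) => X Y; clear - K0 L1; field; lra.
Qed.

Lemma ln_le_sqrt (x : R) : 0 < x -> ln x <= 2 * Num.sqrt x.
Proof.
move=> x0; have s0 : 0 < Num.sqrt x by rewrite sqrtr_gt0.
by rewrite -{1}(sqr_sqrtr (ltW x0)) ln_sqr // ler_wpM2l // ln_le_id.
Qed.

Lemma near_ln_ge (A : R) : \forall n \near \oo, A <= ln (n%:R : R).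
Proof.
have := nbhs_infty_ger (expR A); apply: filterS => n h.
by rewrite -[A]expRK ler_ln ?posrE ?expR_gt0 //; apply: lt_le_trans h; exact: expR_gt0.
Qed.

End LowerSum.

(** ln E differs from rho L by a constant plus multiples of ln L and ln (4 + L). Bounding these by
    multiples of sqrt L makes the quotient error at most B / sqrt L. *)
Theorem theorem2p2 (R : realType) (alpha beta : R) :
  0 < alpha < 1 -> 0 < beta < 1 ->
  (fun n : nat => ln (Epairs alpha beta n) / ln (n%:R : R)) @ \oo
    --> rho2 alpha beta.
Proof.
move=> a01 b01; have /andP[a0 a1] := a01.
have [c [A [c0 hA]]] := Epairs_lower a01 b01.
pose C : R := 144 * expR 266.
have C0 : 0 < C by rewrite mulr_gt0 // expR_gt0.
(* 12 = 2 * 6 pays for the squared factor of the upper bound, as ln (4 + L) <= 6 sqrt L; the lower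
   bound loses 4 * 2 = 8. *)
pose B : R := `|ln c| + `|ln C| + 12.
have B0 : 0 <= B by rewrite !addr_ge0.
apply/cvgrPdist_le => e e0.
have := near_ln_ge (A + 1 + `|A| + (B / e) ^+ 2); apply: filterS => n.
set L := ln n%:R => hL.
have AA : 0 <= A + `|A| by have := ler_norm (- A); rewrite normrN; lra.
have Be := sqr_ge0 (B / e).
have L1 : 1 <= L by lra.
have LA : A <= L by have := normr_ge0 A; lra.
have LB : (B / e) ^+ 2 <= L by lra.
have L0 : 0 < L by lra.
have n1 : (1 < n)%N.
  by case: n @L {hL LB LA} L1 L0 => [|[|n]] //= ; rewrite ?ln1 ?ln0 //; lra.
set s := Num.sqrt L.
have s0 : 0 < s by rewrite sqrtr_gt0.
have s2 : s ^+ 2 = L by rewrite sqr_sqrtr // ltW.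
have s1 : 1 <= s by rewrite -[leLHS]sqrtr1 ler_sqrt // ltW.
have sB : B <= e * s.
  rewrite mulrC -ler_pdivrMr // /s -[leLHS]ger0_norm; last by rewrite divr_ge0 // ltW.
  by rewrite -sqrtr_sqr ler_sqrt // ltW.
set E := Epairs alpha beta n; set rho := rho2 alpha beta.
have lo : c * expR (rho * L) / L ^+ 4 <= E := hA n LA.
have up : E <= C * expR (rho * L) * (4 + L) ^+ 2 := Epairs_upper a0 a1 b01 n1.
have lo0 : 0 < c * expR (rho * L) / L ^+ 4.
  by rewrite divr_gt0 ?exprn_gt0 // mulr_gt0 // expR_gt0.
have E0 : 0 < E by apply: lt_le_trans lo0 lo.
have L40 : 0 < 4 + L by lra.
have up' : ln E <= ln C + rho * L + 2 * ln (4 + L).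
  apply: le_trans (_ : ln (C * expR (rho * L) * (4 + L) ^+ 2) <= _).
    by rewrite ler_ln ?posrE //; apply: lt_le_trans up.
  have CE0 : 0 < C * expR (rho * L) by rewrite mulr_gt0 // expR_gt0.
  by rewrite lnZ_sqr // lnM ?posrE ?expR_gt0 // expRK.
have lo' : ln c + rho * L - 4 * ln L <= ln E.
  apply: le_trans (_ : ln (c * expR (rho * L) / L ^+ 4) <= _); last first.
    by rewrite ler_ln ?posrE.
  rewrite ln_div ?posrE ?exprn_gt0 // ?mulr_gt0 ?expR_gt0 //.
  by rewrite lnM ?posrE ?expR_gt0 // expRK lnXn // mulr_natl.
have lnL : ln L <= 2 * s by exact: ln_le_sqrt.
have ln4L : ln (4 + L) <= 6 * s.
  apply: le_trans (ln_le_sqrt L40) _.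
  have : Num.sqrt (4 + L) <= Num.sqrt ((3 * s) ^+ 2).
    by rewrite ler_sqrt ?sqr_ge0 // exprMn s2; move: L1; clear; lra.
  by rewrite sqrtr_sqr ger0_norm; move: s0; clear; lra.
have nc := ler_norm (- ln c); have nC := ler_norm (ln C).
rewrite normrN in nc.
have ac := normr_ge0 (ln c); have aC := normr_ge0 (ln C).
have -> : rho - ln E / L = (rho * L - ln E) / L by clear - L0; field; lra.
rewrite normrM [`|L^-1|]gtr0_norm ?invr_gt0 // ler_pdivrMr //.
apply: le_trans (_ : B * s <= _); last first.
  by rewrite -s2 expr2 mulrA ler_wpM2r // ltW.
have hc : `|ln c| * 1 <= `|ln c| * s by rewrite ler_wpM2l.
have hC : `|ln C| * 1 <= `|ln C| * s by rewrite ler_wpM2l.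
rewrite ler_norml /B; move: up' lo' lnL ln4L nc nC hc hC ac aC s0; clear.
move: (ln c) (ln C) (`|ln c|) (`|ln C|) (ln E) (ln L) (ln (4 + L)) (rho * L).
by move=> *; apply/andP; split; lra.
Qed.
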